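(* Let $a>0$, $c>0$, $M>0$ and $0<\gamma_0<\gamma_1$ be real numbers satisfying $$\gamma_0<\frac{a}{2},\qquad \gamma_1<\min\left\{\frac{a}{2},\,2c^2\right\},\qquad 3(M^2+2M)\gamma_1^2-8c^2\gamma_1+3ac^2\ge 0 .$$ Let $\tau\in\mathbb{R}$. Then the solution $(s(t),y(t),x(t))$, $t\ge\tau$, of the drilling system with load parameter $\gamma=\gamma_1$, that is, of $$\dot s\in ay+\widetilde M_f(s),\qquad \dot y=-cy-s-xs,\qquad \dot x=-cx+ys,$$ $$\widetilde M_f(s)=\begin{cases}\{\gamma_1\}, & s<c,\\ [-\gamma_1M,\gamma_1], & s=c,\\ \{-\gamma_1M\}, & s>c,\end{cases}$$ with initial data $$s(\tau)=s_0:=\frac{c\left(a-\sqrt{a^2-4\gamma_0^2}\right)}{2\gamma_0},\qquad y(\tau)=-\frac{\gamma_0}{a},\qquad x(\tau)=-\frac{\gamma_0 s_0}{ac},$$ tends to an equilibrium state of this system as $t\to+\infty$.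
   Context: The system is a model of a drill actuated by an induction motor; $a$, $c$ are positive constants, $M$ is a positive constant (assumed large), and the load parameter jumps at time $\tau$ from $\gamma_0$ to $\gamma_1$. A solution of a differential inclusion $\dot u\in F(u)$ with multivalued right-hand side is an absolutely continuous function $u(t)$ such that $\dot u(t)\in F(u(t))$ for those $t$ at which $\dot u(t)$ exists. Equivalently, for each solution of the drilling system there is a function $\widetilde M_{f0}(t)\in\widetilde M_f(s(t))$ (the extended nonlinearity) such that $\dot s(t)=ay(t)+\widetilde M_{f0}(t)$, $\dot y(t)=-cy(t)-s(t)-x(t)s(t)$, $\dot x(t)=-cx(t)+y(t)s(t)$ for almost all $t$. An equilibrium state is a constant solution. *)

(* Defs.v *)
From mathcomp Require Import all_boot all_order all_algebra.
From mathcomp Require Import all_classical all_reals all_analysis.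
Import Order.TTheory GRing.Theory Num.Theory.
Import numFieldNormedType.Exports.

Set Implicit Arguments.
Unset Strict Implicit.
Unset Printing Implicit Defensive.

Local Open Scope classical_set_scope.
Local Open Scope ring_scope.

Definition absolutely_continuous (R : realType) (V : normedModType R)
    (A B : R) (u : R -> V) : Prop :=
  forall e : R, 0 < e -> exists2 d : R, 0 < d &
  forall (n : nat) (p q : 'I_n -> R),
    (forall i, [/\ A <= p i, p i < q i & q i <= B]) ->
    (forall i j, i != j -> q i <= p j \/ q j <= p i) ->
    \sum_i (q i - p i) < d -> \sum_i `|u (q i) - u (p i)| < e.

(* Solution on the half-line [tau, +oo[ of the autonomous differential inclusion
   u' \in F u; the values u t for t < tau are irrelevant.  Absolute continuity
   on an unbounded interval means absolute continuity on each of its compact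
   subintervals. *)
Definition is_solution (R : realType) (V : normedModType R)
    (F : V -> set V) (tau : R) (u : R -> V) : Prop :=
  (forall T : R, tau < T -> absolutely_continuous tau T u) /\
  (forall t : R, tau < t -> derivable u t 1 -> F (u t) ('D_1 u t)).

Definition is_equilibrium (R : realType) (V : normedModType R)
    (F : V -> set V) (p : V) : Prop :=
  forall tau : R, is_solution F tau (fun=> p).

Definition Mf_ext (R : realType) (c M gamma s : R) : set R :=
  if s < c then [set gamma]
  else if s == c then `[- (gamma * M), gamma]%classic
  else [set - (gamma * M)].

(* The state is the triple (s, y, x). *)
Definition drilling_system (R : realType) (a c M gamma : R)
    (u : R * R * R) : set (R * R * R) :=
  let: (s, y, x) := u in
  [set v | exists2 m, Mf_ext c M gamma s m &
    v = (a * y + m, - c * y - s - x * s, - c * x + y * s)].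

(* Main.v *)
From HB Require Import structures.
Require Import Defs.
From mathcomp Require Import all_boot all_order all_algebra finmap.
From mathcomp Require Import all_classical all_reals all_analysis.
From mathcomp Require Import measurable_realfun ring lra.
Import Order.TTheory GRing.Theory Num.Theory.
Import numFieldNormedType.Exports.

Set Implicit Arguments.
Unset Strict Implicit.
Unset Printing Implicit Defensive.

Local Open Scope classical_set_scope.
Local Open Scope ring_scope.

(** Write g for the load [gamma1].  In the coordinates
      e = a y + g,   z = - x - g s / (a c)
    the system reads
      s' = e  (for s < c),
      e' = - c e + a z s + psi s,
      z' = - c z - e s / a - g / (a c) s',
    where psi s = (g s^2 - a c s + c^2 g) / c is the quadratic [restoring],
    and the equilibrium is e = z = 0, s = s1, with s1 < c the smaller root of
    [restoring].  With [potential] a primitive of its opposite, the energy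
      V = e^2 / 2 + a^2 z^2 / 2 + potential s
    satisfies V' <= - k (e^2 + a^2 z^2) as long as s <= c: for s < c this is the
    condition g < 2 c^2, and for a motion sliding along s = c, where s' = 0, it
    follows from [restoring c] = c (2 g - a) < 0 ([energy_rate]).

    The motion never leaves s <= c ([no_exit]).  At a first exit time s = c, and
    the energy bound gives e^2 / 2 <= V(tau) - potential c, which is smaller
    than ((M + 1) g)^2 / 2: the initial energy is smaller than g^2 / 2
    ([initial_energy]), and the last hypothesis of the theorem says precisely
    that g^2 / 2 <= potential c + ((M + 1) g)^2 / 2.  Hence e < (M + 1) g at the
    exit, so that s' = e - (M + 1) g < 0 as soon as s > c, and s cannot exceed c.

    On s <= c the potential is coercive ([energy_coercive]), so the motion is
    bounded, hence Lipschitz.  An argument in the manner of Barbalat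
    ([barbalat_inequality]) applied to V gives e, z -> 0; applied to e and - e
    it gives [restoring] (s t) -> 0, hence s -> s1 since s1 is the only root in
    ]-oo, c].

    A solution is only known to be absolutely continuous and to satisfy the
    inclusion where it is derivable, so all of this rests on two facts about an
    absolutely continuous real function: it is derivable almost everywhere
    ([ac_ae_derivable]), and it is nonincreasing when its derivative is
    nonpositive almost everywhere ([ac_nonincreasing]).  For the first, the
    points from which the function has increments of arbitrarily large slope
    form a null set, by the covering lemma of Vitali ([steep_null]).  Elsewhere
    the function touches its upper and its lower envelope for some Lipschitz
    constant; these two functions are derivable almost everywhere
    ([lipschitz_ae_derivable], from the theorems of Radon-Nikodym and Lebesgue)
    and squeeze the given one. *)

(** * Difference quotients *)

Lemma is_derive_mul (R : realType) (f g : R -> R) (t df dg : R) :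
  is_derive t 1 f df -> is_derive t 1 g dg ->
  is_derive t 1 (f * g) (f t * dg + g t * df).
Proof. by move=> Df Dg; exact: (is_deriveM Df Dg). Qed.

Lemma is_derive_scale (R : realType) (k : R) (f : R -> R) (t df : R) :
  is_derive t 1 f df -> is_derive t 1 (cst k * f) (k * df).
Proof.
move=> Df; apply: (is_derive_eq (is_derive_mul (is_derive_cst k t 1) Df)).
by rewrite mulr0 addr0.
Qed.

Lemma derive_quotient (R : realType) (f : R -> R) (x e : R) :
  derivable f x 1 -> 0 < e ->
  exists2 r, 0 < r & forall h, 0 < `|h| < r ->
    `|'D_1 f x - h^-1 * (f (x + h) - f x)| < e.
Proof.
move=> df e0.
have : h^-1 *: (f (h *: (1 : R) + x) - f x) @[h --> 0^'] --> 'D_1 f x by exact: df.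
move=> /cvgrPdist_lt/(_ _ e0).
rewrite /nbhs/= /dnbhs /within/= => -[r r0 hr]; exists r => // h /andP[h0 hltr].
have := hr h; rewrite /ball/= sub0r normrN => /(_ hltr).
rewrite -normr_gt0 h0 => /(_ isT).
by rewrite (_ : h *: (1 : R) + x = x + h) // addrC [h *: _]mulr1.
Qed.

Lemma quotient_derive (R : realType) (f : R -> R) (x l : R) :
  (forall e, 0 < e -> exists2 r, 0 < r & forall h, 0 < `|h| < r ->
    `|l - h^-1 * (f (x + h) - f x)| < e) ->
  is_derive x 1 f l.
Proof.
move=> H.
have cv : h^-1 *: (f (h *: (1 : R) + x) - f x) @[h --> 0^'] --> l.
  apply/cvgrPdist_lt => e /H[r r0 hr].
  rewrite /nbhs/= /dnbhs /within/=; exists r => //= h.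
  rewrite /ball/= sub0r normrN => hltr.
  rewrite -normr_gt0 => h0; rewrite (_ : h *: (1 : R) + x = x + h).
    by apply: hr; rewrite h0.
  by rewrite addrC [h *: _]mulr1.
have df : derivable f x 1 by apply/cvg_ex; exists l.
by split => //; apply: cvg_lim cv; exact: Rhausdorff.
Qed.

(** Derivability is assumed at the maximum only, which is all that is available
    for a solution: right quotients are nonpositive and left ones nonnegative. *)
Lemma local_max_derive0 (R : realType) (f : R -> R) (x r : R) :
  derivable f x 1 -> 0 < r -> (forall h, `|h| < r -> f (x + h) <= f x) ->
  'D_1 f x = 0.
Proof.
move=> df r0 fmax; apply/eqP/negPn/negP => D0.
have [|r' r'0 hr'] := @derive_quotient _ _ _ `|'D_1 f x| df.
  by rewrite normr_gt0.
pose k := Num.min r r' / 2.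
have k0 : 0 < k by rewrite divr_gt0// lt_min r0.
have kr : k < r by rewrite /k ltr_pdivrMr// gt_min; apply/orP; left; lra.
have kr' : k < r' by rewrite /k ltr_pdivrMr// gt_min; apply/orP; right; lra.
have [Dp|Dn] := ltP 0 ('D_1 f x).
  have := hr' k; rewrite gtr0_norm// k0 kr' => /(_ isT).
  have : k^-1 * (f (x + k) - f x) <= 0.
    by rewrite pmulr_rle0 ?invr_gt0// subr_le0 fmax// gtr0_norm.
  by rewrite (gtr0_norm Dp) ltr_norml => h /andP[_]; lra.
have {D0}Dn : 'D_1 f x < 0 by rewrite lt_neqAle D0.
have := hr' (- k); rewrite normrN gtr0_norm// k0 kr' => /(_ isT).
have : 0 <= (- k)^-1 * (f (x - k) - f x).
  rewrite invrN mulNr -mulrN pmulr_rge0 ?invr_gt0// oppr_ge0.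
  by rewrite subr_le0 fmax// normrN gtr0_norm.
by rewrite (ltr0_norm Dn) ltr_norml => h /andP[]; lra.
Qed.

(** Since [g - f] has a minimum at [x], both derivatives agree there, and every
    difference quotient of [F] lies between those of [f] and [g]. *)
Lemma derivable_squeeze (R : realType) (f g F : R -> R) (x : R) :
  derivable f x 1 -> derivable g x 1 -> (forall y, f y <= F y <= g y) ->
  f x = F x -> g x = F x -> derivable F x 1.
Proof.
move=> df dg fFg fx gx.
have D0 : 'D_1 f x = 'D_1 g x.
  apply/eqP; rewrite -subr_eq0 -deriveB//; apply/eqP.
  apply: (local_max_derive0 (derivableB df dg) ltr01) => h _.
  rewrite !fctE fx gx subrr subr_le0.
  by case/andP: (fFg (x + h)); exact: le_trans.
suff : is_derive x 1 F ('D_1 f x) by case.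
apply: quotient_derive.
move=> e e0.
have [r1 r10 h1] := derive_quotient df e0; have [r2 r20 h2] := derive_quotient dg e0.
exists (Num.min r1 r2); first by rewrite lt_min r10.
move=> h /andP[h0]; rewrite lt_min => /andP[hr1 hr2].
have := h1 h; have := h2 h; rewrite h0 hr1 hr2 -D0 fx gx => /(_ isT) + /(_ isT).
rewrite !ltr_norml => /andP[g1 g2] /andP[f1 f2].
have /andP[fF Fg] := fFg (x + h).
case: (ltgtP h 0) h0 => [hn _|hp _|->]; last by rewrite normr0 ltxx.
  have Q1 : h^-1 * (F (x + h) - F x) <= h^-1 * (f (x + h) - F x).
    by rewrite ler_nM2l ?invr_lt0// lerB.
  have Q2 : h^-1 * (g (x + h) - F x) <= h^-1 * (F (x + h) - F x).
    by rewrite ler_nM2l ?invr_lt0// lerB.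
  by apply/andP; split; lra.
have Q1 : h^-1 * (f (x + h) - F x) <= h^-1 * (F (x + h) - F x).
  by rewrite ler_pM2l ?invr_gt0// lerB.
have Q2 : h^-1 * (F (x + h) - F x) <= h^-1 * (g (x + h) - F x).
  by rewrite ler_pM2l ?invr_gt0// lerB.
by apply/andP; split; lra.
Qed.

(** Straddle form of the derivative: the increment is controlled over every
    small interval around [x], not only over those with [x] as an endpoint. *)
Lemma le0_slope_near (R : realType) (F : R -> R) (x e : R) :
  derivable F x 1 -> 'D_1 F x <= 0 -> 0 < e ->
  exists2 r, 0 < r & forall y z, x - r < y -> y <= x -> x <= z -> z < x + r ->
    F z - F y <= e * (z - y).
Proof.
move=> dF dF0 e0; have [r r0 hr] := derive_quotient dF e0.
have main h : 0 < `|h| < r -> h^-1 * (F (x + h) - F x) <= e.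
  by move=> /hr; rewrite ltr_norml => /andP[h1 _]; lra.
have right z : x <= z -> z < x + r -> F z - F x <= e * (z - x).
  rewrite le_eqVlt => /predU1P[-> _|xz zr]; first by rewrite !subrr mulr0.
  have zx : 0 < z - x by rewrite subr_gt0.
  have := main (z - x); rewrite gtr0_norm// zx/= ltrBlDl => /(_ zr).
  rewrite (_ : x + (z - x) = z); last by ring.
  by rewrite mulrC ler_pdivrMr.
have left y : x - r < y -> y <= x -> F x - F y <= e * (x - y).
  move=> yr; rewrite le_eqVlt => /predU1P[->|yx]; first by rewrite !subrr mulr0.
  have xy : 0 < x - y by rewrite subr_gt0.
  have := main (y - x); rewrite -opprB normrN gtr0_norm// xy/=.
  rewrite (_ : x - (x - y) = y); last by ring.
  rewrite invrN mulNr -mulrN opprB mulrC ler_pdivrMr//; apply.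
  by rewrite ltrBlDr addrC -ltrBlDr.
exists r => // y z xry yx xz zxr.
have := right z xz zxr; have := left y xry yx; lra.
Qed.

(** * Absolute continuity over families of disjoint intervals *)

(** Finite lists of pairs, rather than functions on ordinals, because the proofs
    below extend, filter and truncate these families. *)
Definition disjoint_pairs (R : realType) (s : seq (R * R)) : bool :=
  all (fun p => p.1 <= p.2) s &&
  pairwise (fun p q => (p.2 <= q.1) || (q.2 <= p.1)) s.

Definition ac_line (R : realType) (F : R -> R) : Prop :=
  forall e : R, 0 < e -> exists2 d : R, 0 < d &
  forall s : seq (R * R), disjoint_pairs s ->
    \sum_(p <- s) (p.2 - p.1) < d -> \sum_(p <- s) `|F p.2 - F p.1| < e.

(** Composing with [clamp A B] extends a function on [[A, B]] to the whole line
    without creating any new increment, which lets the arguments below drop the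
    segment. *)
Definition clamp (R : realType) (A B x : R) : R := Num.max A (Num.min B x).

Lemma clamp_id (R : realType) (A B x : R) : A <= x <= B -> clamp A B x = x.
Proof. by move=> /andP[Ax xB]; rewrite /clamp min_r// max_r. Qed.

Lemma clamp_in (R : realType) (A B x : R) : A <= B -> A <= clamp A B x <= B.
Proof.
by move=> AB; rewrite /clamp le_max lexx/= ge_max AB/= ge_min lexx.
Qed.

Lemma clamp_le (R : realType) (A B x y : R) : x <= y ->
  clamp A B x <= clamp A B y /\ clamp A B y - clamp A B x <= y - x.
Proof.
rewrite /clamp => xy.
have [Bx|xB] := leP B x; have [By|yB] := leP B y; have [AB|BA] := leP A B;
  have [Ax|xA] := leP A x; have [Ay|yA] := leP A y => //; split; lra.
Qed.

Lemma ac_line_clamp (R : realType) (A B : R) (f : R -> R) : A <= B ->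
  absolutely_continuous A B f -> ac_line (f \o clamp A B).
Proof.
move=> AB acf e e0; have [d d0 H] := acf e e0; exists d => // s0 /andP[le0 pw0] sd.
pose C := clamp A B.
(* Degenerate images are discarded, because absolute continuity on a segment
   quantifies over nondegenerate intervals. *)
pose s := [seq p <- [seq (C p.1, C p.2) | p <- s0] | p.1 < p.2].
have sE (G : R * R -> R) : (forall x, G (x, x) = 0) ->
    \sum_(p <- s) G p = \sum_(p <- s0) G (C p.1, C p.2).
  move=> G0; rewrite /s big_filter big_map big_mkcond big_seq [RHS]big_seq.
  apply: eq_bigr => p ps; case: ifPn => //; rewrite -leNgt => h.
  have [h' _] := clamp_le A B (allP le0 _ ps).
  by have -> : C p.2 = C p.1 by apply/le_anti/andP; split.
have pws : pairwise (fun p q => (p.2 <= q.1) || (q.2 <= p.1)) s.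
  apply: pairwise_filter; rewrite pairwise_map; apply: sub_pairwise pw0 => p q /=.
  by move=> /orP[] /(clamp_le A B)[-> _]//; rewrite orbT.
have sP p : p \in s -> [/\ A <= p.1, p.1 < p.2 & p.2 <= B].
  rewrite mem_filter => /andP[p12 /mapP[q _ qE]]; split => //; rewrite qE/=.
    by case/andP: (clamp_in q.1 AB).
  by case/andP: (clamp_in q.2 AB).
have nthE (G : R * R -> R) :
    \sum_(p <- s) G p = \sum_(i < size s) G (nth (0, 0) s i).
  by rewrite (big_nth (0, 0)) big_mkord.
have := H (size s) (fun i => (nth (0, 0) s i).1) (fun i => (nth (0, 0) s i).2).
rewrite -(nthE (fun p => p.2 - p.1)) -(nthE (fun p => `|f p.2 - f p.1|)).
rewrite (sE (fun p => p.2 - p.1)); last by move=> x; rewrite subrr.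
rewrite (sE (fun p => `|f p.2 - f p.1|)); last by move=> x; rewrite subrr normr0.
apply.
- by move=> i; apply: sP; exact: mem_nth.
- move=> i j ij.
  have h (k l : 'I_(size s)) : (k < l)%N ->
      ((nth (0, 0) s k).2 <= (nth (0, 0) s l).1) ||
      ((nth (0, 0) s l).2 <= (nth (0, 0) s k).1).
    by move=> kl; move/(pairwiseP (0, 0)): pws; apply => //; rewrite inE ltn_ord.
  case: (ltngtP i j) => [/h/orP//|/h|/val_inj/eqP]; last by rewrite (negbTE ij).
  by rewrite orbC => /orP.
- apply: le_lt_trans sd; rewrite big_seq [leRHS]big_seq.
  by apply: ler_sum => p /(allP le0) /(clamp_le A B)[].
Qed.

Lemma ac_line_continuous (R : realType) (F : R -> R) :
  ac_line F -> continuous F.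
Proof.
move=> acF x; apply/cvgrPdist_lt => e e0; have [d d0 H] := acF e e0.
near=> y.
have xyd : `|x - y| < d by near: y; exact: cvgr_dist_lt.
have [xy|yx] := leP x y.
  rewrite distrC; have := H [:: (x, y)]; rewrite !big_seq1/=; apply.
    by rewrite /disjoint_pairs/= xy.
  by move: xyd; rewrite ler0_norm ?subr_le0// opprB.
have := H [:: (y, x)]; rewrite !big_seq1/=; apply.
  by rewrite /disjoint_pairs/= ltW.
by move: xyd; rewrite ger0_norm// subr_ge0 ltW.
Unshelve. all: by end_near. Qed.

(** * Monotonicity from the sign of the derivative almost everywhere *)

(** Given [e], the exceptional null set is covered by an open set [O] of measure
    less than the [d] of absolute continuity.  Moving [t] from [A] to [B], the
    increment of [F] is paid either by [e * (t - A)], around points with a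
    nonpositive derivative, or by the variation of [F] over disjoint intervals
    inside [O], which stays below [e].  The supremum of the reachable [t] is
    reachable, and would be exceeded if it were smaller than [B]. *)
Lemma ac_line_le (R : realType) (A B : R) (F : R -> R) : A <= B ->
  ac_line F ->
  {ae @lebesgue_measure R,
    forall x, A < x < B -> derivable F x 1 /\ 'D_1 F x <= 0} ->
  F B <= F A.
Proof.
move=> AB acF [N0 [mN0 N00 N0P]].
(* No derivative is given at the endpoints: they join the exceptional set. *)
pose N := N0 `|` [set A] `|` [set B].
have mN : measurable N by do 2 apply: measurableU => //.
have muN : lebesgue_measure N = 0%E.
  have set1 (r : R) : lebesgue_measure [set r] = 0%E by exact: lebesgue_measure_set1.
  apply: (etrans (measureU0 _ _ (set1 B))) => //; first exact: measurableU.
  by apply: (etrans (measureU0 _ _ (set1 A))).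
suff key e : 0 < e -> F B - F A <= e * (B - A) + e.
  apply/ler_addgt0Pr => e e0.
  have BA1 : 0 < B - A + 1 by lra.
  have := key (e / (B - A + 1)); rewrite divr_gt0// => /(_ isT).
  have -> : e / (B - A + 1) * (B - A) + e / (B - A + 1) = e by field; lra.
  lra.
move=> e0; have [d d0 H] := acF e e0.
have [|O [oO NO muO]] := lebesgue_regularity_outer mN _ d0.
  by rewrite [X in (X < _)%E]muN.
have {}muO : (lebesgue_measure O < d%:E)%E.
  apply: le_lt_trans muO.
  rewrite -{1}(setDKU NO).
  apply: (le_trans (measureU2 _ _ _)) => //.
    by apply: measurableD => //; exact: open_measurable.
  by rewrite [X in (_ + X)%E]muN adde0.
have mO : measurable O by exact: open_measurable.
(* The lengths are charged to O below t, which bounds them by d in the end. *)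
pose fam t (s : seq (R * R)) := [/\ disjoint_pairs s,
  all (fun p => p.2 <= t) s,
  ((\sum_(p <- s) (p.2 - p.1))%:E <= lebesgue_measure (O `&` `]A, t]%classic))%E &
  F t - F A <= e * (t - A) + \sum_(p <- s) `|F p.2 - F p.1|].
pose P := [set t | A <= t <= B /\ exists s, fam t s].
have PA : P A.
  split; first by rewrite lexx AB.
  by exists [::]; split; rewrite ?big_nil// !subrr mulr0 addr0.
have step t t' : P t -> t <= t' -> t' <= B ->
    (`]t, t']%classic `<=` O \/ F t' - F t <= e * (t' - t)) -> P t'.
  move=> [/andP[At tB] [s [/andP[s1 s2] st sO sF]]] tt' t'B.
  have st' : all (fun p => p.2 <= t') s.
    by apply/allP => p /(allP st) h; exact: le_trans tt'.
  case=> h; split; rewrite ?t'B ?(le_trans At)//.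
    exists (rcons s (t, t')); split => //.
    - apply/andP; split; first by rewrite all_rcons/= tt'.
      rewrite pairwise_rcons s2 andbT; apply/allP => p /(allP st)/= ->//.
    - by rewrite all_rcons/= lexx.
    - rewrite -cats1 big_cat big_seq1/= EFinD.
      have -> : O `&` `]A, t']%classic = (O `&` `]A, t]%classic) `|` `]t, t']%classic.
        rewrite -[X in _ `|` X](setIidr h) -setIUr; congr (_ `&` _).
        by rewrite -itv_bndbnd_setU// bnd_simp.
      rewrite measureU//=; last 2 first.
        exact: measurableI.
        rewrite -subset0 => x/=; rewrite !in_itv/= => -[[_ /andP[_ xt]] /andP[]].
        by rewrite ltNge xt.
      apply: leeD => //; rewrite lebesgue_measure_itv/= lte_fin.
      case: ifPn => //; rewrite -leNgt => t't.
      by rewrite lee_fin subr_le0.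
    - rewrite -cats1 big_cat big_seq1/=.
      have : 0 <= e * (t' - t) by rewrite mulr_ge0 ?subr_ge0// ltW.
      have := ler_norm (F t' - F t); lra.
  exists s; split => //; first exact/andP.
    apply: (le_trans sO); apply: le_measure; rewrite ?inE;
      [exact: measurableI|exact: measurableI|].
    by apply: setIS; apply: subset_itvl; rewrite bnd_simp.
  lra.
have local T : A <= T <= B -> exists2 r, 0 < r & forall t t', P t -> T - r < t ->
    t <= T -> T <= t' -> t' < T + r -> t' <= B -> P t'.
  move=> /andP[AT TB]; have [OT|nOT] := pselect (O T).
    move: oO; rewrite openE => /(_ _ OT) [r/= r0 rO]; exists r => //.
    move=> t t' Pt rt tT Tt' t'r t'B; apply: (step t) => //.
      exact: le_trans Tt'.
    left=> x/=; rewrite in_itv/= => /andP[tx xt']; apply: rO.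
    by rewrite /ball/= ltr_norml; apply/andP; split; lra.
  have ATB : A < T < B.
    rewrite !lt_neqAle AT TB !andbT; apply/andP; split; apply/eqP => TE; apply: nOT;
      apply: NO; rewrite /N/=.
      by left; right.
    by right.
  have [dF dF0] : derivable F T 1 /\ 'D_1 F T <= 0.
    apply: contrapT => h; apply: nOT; apply: NO; left; left.
    by apply: N0P => /= /(_ ATB).
  have [r r0 hr] := le0_slope_near dF dF0 e0; exists r => //.
  move=> t t' Pt rt tT Tt' t'r t'B; apply: (step t) => //.
    exact: le_trans Tt'.
  by right; exact: hr.
have PB : P B.
  have supP : has_sup P by split; [exists A|exists B => t [/andP[]]].
  have ATB : A <= sup P <= B.
    apply/andP; split; first exact: ub_le_sup supP.2 _ PA.
    by apply: ge_sup; [exists A|move=> t [/andP[]]].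
  have [r r0 hr] := local _ ATB.
  have [t Pt rt] := sup_adherent r0 supP.
  have tT : t <= sup P by exact: ub_le_sup supP.2 _ Pt.
  have [BT|TB] := leP B (sup P).
    by apply: (hr t) => //; [case/andP: ATB|lra].
  pose t' := Num.min B (sup P + r / 2).
  have Tt' : sup P < t' by rewrite /t' lt_min TB ltrDl divr_gt0.
  have : P t'.
    apply: (hr t) => //; rewrite ?(ltW Tt')// /t'.
      by rewrite gt_min; apply/orP; right; lra.
    by rewrite ge_min lexx.
  by move=> /(ub_le_sup supP.2); rewrite leNgt Tt'.
have [_ [s [s1 s2 s3 s4]]] := PB.
have : \sum_(p <- s) `|F p.2 - F p.1| < e.
  apply: H => //; rewrite -lte_fin (le_lt_trans s3)//.
  by apply: le_lt_trans muO; apply: le_measure; rewrite ?inE//; exact: measurableI.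
lra.
Qed.

(** * Almost everywhere derivability of Lipschitz functions *)

Lemma ae_imply2 (R : realType) (P Q S : R -> Prop) :
  (forall x, P x -> Q x -> S x) ->
  {ae @lebesgue_measure R, forall x, P x} ->
  {ae @lebesgue_measure R, forall x, Q x} ->
  {ae @lebesgue_measure R, forall x, S x}.
Proof.
move=> PQS; apply: (@filterS2 _ _ (ae_filter_ringOfSetsType lebesgue_measure)).
exact: PQS.
Qed.

Lemma ae_imply (R : realType) (P Q : R -> Prop) :
  (forall x, P x -> Q x) ->
  {ae @lebesgue_measure R, forall x, P x} ->
  {ae @lebesgue_measure R, forall x, Q x}.
Proof. by move=> PQ aeP; apply: (ae_imply2 _ aeP aeP) => x /PQ. Qed.

Lemma global_lipschitz_continuous (R : realType) (K : R) (f : R -> R) :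
  (forall x y, `|f x - f y| <= K * `|x - y|) -> continuous f.
Proof.
move=> fK x; apply/cvgrPdist_le => e e0.
have K1 : 0 < `|K| + 1 by rewrite ltr_wpDl.
near=> y.
apply: (le_trans (fK x y)).
apply: (@le_trans _ _ ((`|K| + 1) * `|x - y|)).
  by rewrite ler_wpM2r// (le_trans (ler_norm _))// lerDl.
rewrite -ler_pdivlMl//.
near: y; apply: cvgr_dist_le => //; rewrite mulr_gt0// invr_gt0//.
Unshelve. all: by end_near. Qed.

Lemma lebesgue_stieltjes_ocitv (R : realType) (f : cumulative R R) (p q : R) :
  p <= q -> lebesgue_stieltjes_measure f `]p, q]%classic = (f q - f p)%:E.
Proof.
move=> pq; rewrite /lebesgue_stieltjes_measure/= /measure_extension.
rewrite measurable_mu_extE/=; last exact: is_ocitv.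
by rewrite wlength_itv_bnd.
Qed.

(** [K x + L x] and [K x - L x] are nondecreasing and their Lebesgue-Stieltjes
    measures add up to [2 K] times the Lebesgue measure.  The first one is
    therefore absolutely continuous, [K x + L x] is the integral of its density,
    and is derivable at the Lebesgue points of that density. *)
Lemma lipschitz_ae_derivable (R : realType) (A B K : R) (L : R -> R) :
  (forall x y, `|L x - L y| <= K * `|x - y|) ->
  {ae @lebesgue_measure R, forall x, A < x < B -> derivable L x 1}.
Proof.
wlog K0 : K / 0 < K => [h LK|LK].
  apply: (h (`|K| + 1)); first by rewrite ltr_wpDl.
  move=> x y; apply: (le_trans (LK x y)).
  by rewrite ler_wpM2r// (le_trans (ler_norm _))// lerDl.
have [BA|AB] := leP B A.
  apply: aeW => x /andP[Ax xB]; move: (lt_trans Ax xB).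
  by rewrite ltNge BA.
have Lc := global_lipschitz_continuous LK.
pose h1 (x : R) := K * x + L x; pose h2 (x : R) := K * x - L x.
have lin x y : x <= y -> `|L y - L x| <= K * (y - x).
  by move=> xy; rewrite (le_trans (LK _ _))// ger0_norm ?subr_ge0.
have nd1 : nondecreasing h1.
  by move=> x y /lin; rewrite /h1 ler_norml => /andP[]; lra.
have nd2 : nondecreasing h2.
  by move=> x y /lin; rewrite /h2 ler_norml => /andP[]; lra.
have rc1 : right_continuous h1.
  apply: right_continuousW => x; apply: cvgD; last exact: Lc.
  by apply: cvgM; [exact: cvg_cst|exact: cvg_id].
have rc2 : right_continuous h2.
  apply: right_continuousW => x; apply: cvgB; last exact: Lc.
  by apply: cvgM; [exact: cvg_cst|exact: cvg_id].
pose c1 : cumulative R R := HB.pack h1 (isCumulative.Build R _ R h1 nd1 rc1).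
pose c2 : cumulative R R := HB.pack h2 (isCumulative.Build R _ R h2 nd2 rc2).
pose mu1 := lebesgue_stieltjes_measure c1.
pose mu2 := lebesgue_stieltjes_measure c2.
have K2 : 0 <= (2 * K)^-1 by rewrite invr_ge0 mulr_ge0// ltW.
(* The identity is checked on intervals and extends to Borel sets by
   uniqueness. *)
have muE (X : set (measurableTypeR R)) : measurable X ->
    lebesgue_measure X = ((2 * K)^-1%:E * (mu1 X + mu2 X))%E.
  rewrite -measure_addE; move: X.
  apply: (@lebesgue_measure_unique _
    (mscale (NngNum K2) (measure_add mu1 mu2))) => X [[p q] _ <-] /=.
  have [qp|pq] := ltP q p.
    by rewrite set_itv_ge ?bnd_simp -?ltNge ?measure0// -leNgt ltW.
  rewrite /lebesgue_measure/= lebesgue_stieltjes_ocitv//.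
  rewrite [RHS](_ : _ = (2 * K)^-1%:E *
      (mu1 `]p, q]%classic + mu2 `]p, q]%classic))%E; last first.
    by rewrite -measure_addE.
  rewrite [mu1 _]lebesgue_stieltjes_ocitv// [mu2 _]lebesgue_stieltjes_ocitv//.
  rewrite -EFinD -EFinM /= /h1 /h2; congr (_%:E); field.
  by rewrite gt_eqF.
have mAB : measurable (`]A, B]%classic : set (measurableTypeR R)).
  exact: measurable_itv.
have fin1 : (mu1 `]A, B]%classic < +oo)%E.
  by rewrite [mu1 _]lebesgue_stieltjes_ocitv ?ltry// ltW.
pose nu : {finite_measure set (measurableTypeR R) -> \bar R} := mfrestr mAB fin1.
have nudom : nu `<< @lebesgue_measure R.
  apply/null_content_dominatesP => X mX X0.
  have := muE X mX; rewrite X0 => /esym/eqP.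
  rewrite mule_eq0 eqe invr_eq0 mulf_eq0 pnatr_eq0/= gt_eqF//=.
  rewrite padde_eq0// => /andP[/eqP h _].
  apply/eqP; rewrite -measure_le0 -h /nu/= /mfrestr/= /mrestr.
  by rewrite le_measure// inE//; exact: measurableI.
have [g [g0 gfin gint nuE]] := radon_nikodym_sigma_finite nudom.
pose w := fine \o g.
have wg : EFin \o w = g by apply/funext => x /=; rewrite fineK.
have wint : lebesgue_measure.-integrable setT (EFin \o w) by rewrite wg.
have wloc : locally_integrable setT w.
  exact: open_integrable_locally openT wint.
have wint' y : (@lebesgue_measure R).-integrable [set` Interval (BRight A) (BRight y)]
    (EFin \o w).
  by apply: integrableS wint.
have := FTC1 wint' wloc.
apply: filterS; first exact: (ae_filter_ringOfSetsType lebesgue_measure).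
move=> x /= /[swap] /andP[Ax xB].
move=> /(_ Ax)[dF _].
have FE y : A < y < B ->
    (\int[lebesgue_measure]_(t in [set` `]A, y]]) w t) = h1 y - h1 A.
  move=> /andP[Ay yB].
  rewrite /Rintegral (_ : (\int[_]_(_ in _) _)%E = nu `]A, y]%classic).
    transitivity (fine (mu1 `]A, y]%classic)).
      congr fine; rewrite /nu/= /mfrestr/= /mrestr setIidl//.
      by apply: subset_itvl; rewrite bnd_simp ltW.
    by rewrite [mu1 _](lebesgue_stieltjes_ocitv c1 (ltW Ay)).
  by rewrite nuE// -wg.
have dh : derivable (fun y => h1 y - h1 A) x 1.
  move: dF; apply: near_eq_derivable => //; near=> y.
  rewrite FE//; apply/andP; split; near: y.
    exact: lt_nbhsr.
  exact: lt_nbhsl.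
have -> : L = (fun y => h1 y - h1 A) + (cst (h1 A) - (cst K * id)).
  by apply/funext => y; rewrite !fctE /h1 addrA subrK addrC addKr.
exact: (derivableD dh (derivableB (derivable_cst (h1 A) x 1)
  (derivableM (derivable_cst K x 1) (@derivable_id _ _ x 1)))).
Unshelve. all: by end_near. Qed.

(** * Almost everywhere derivability of absolutely continuous functions *)

(** Increments in both directions and at all distances count: outside of this
    set, the two cones of slope [K] with apex [(x, F x)] enclose the whole graph,
    which is what makes the envelopes touch [F] there. *)
Definition steep (R : realType) (F : R -> R) (K : R) : set R :=
  [set x | exists z, K * `|z - x| < `|F z - F x|].

Lemma open_steep (R : realType) (F : R -> R) (K : R) :
  continuous F -> open (steep F K).
Proof.
move=> cF.
have -> : steep F K =
    \bigcup_z ((fun x => `|F z - F x| - K * `|z - x|) @^-1` [set y | 0 < y]).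
  apply/seteqP; split => [x [z h]|x [z _ h]]; exists z => //=.
    by rewrite subr_gt0.
  by move: h; rewrite /= subr_gt0.
apply: bigcup_open => z _; apply: open_comp; last exact: open_gt.
move=> x _; apply: cvgB.
  by apply: cvg_norm; apply: cvgB; [exact: cvg_cst|exact: cF].
apply: cvgM; first exact: cvg_cst.
by apply: cvg_norm; apply: cvgB; [exact: cvg_cst|exact: cvg_id].
Qed.

(** Adding the terms one by one, each less than [d / 2], the partial sums cannot
    jump over [[d / 2, d[]. *)
Lemma partial_sum_between (R : realType) (I : eqType) (l : I -> R) (d : R) (s : seq I) :
  0 < d -> {in s, forall x, l x < d / 2} -> d / 2 <= \sum_(x <- s) l x ->
  exists k, d / 2 <= \sum_(x <- take k s) l x < d.
Proof.
move=> d0; elim/last_ind: s => [|s x IH] ld.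
  by rewrite big_nil; lra.
move=> h; have [sd|ds] := ltP (\sum_(x <- s) l x) (d / 2).
  exists (size (rcons s x)); rewrite take_size h/=.
  rewrite -cats1 big_cat big_seq1/=.
  by have := ld x; rewrite mem_rcons mem_head => /(_ isT); lra.
have [|k kP] := IH _ ds.
  by move=> y ys; apply: ld; rewrite mem_rcons in_cons ys orbT.
exists (minn k (size s)).
by rewrite -cats1 takel_cat ?geq_minr// take_min take_size.
Qed.

(** From a family of steep intervals one extracts, by the finite covering lemma
    of Vitali, a disjoint subfamily that still carries a fixed proportion of the
    measure.  Its total length is small: otherwise a part of it would have total
    length between [d / 2] and [d], over which [F] would vary by at least 1. *)
Lemma steep_small (R : realType) (F : R -> R) (C e : R) :
  ac_line F -> (forall x, `|F x| <= C) -> 0 < e ->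
  exists n : nat, (@lebesgue_measure R (steep F n%:R) <= e%:E)%E.
Proof.
move=> acF FC e0; have [d1 d10 H] := acF 1 ltr01.
(* The set is covered by balls of radius 3 * (2 * l x), hence has measure at
   most 12 * (d / 2). *)
pose d := Num.min d1 (e / 6).
have d0 : 0 < d by rewrite lt_min d10 divr_gt0.
have dd1 : d <= d1 by rewrite ge_min lexx.
have de : 6 * d <= e by rewrite -ler_pdivlMl// mulrC ge_min lexx orbT.
have C0 : 0 <= C by apply: le_trans (FC 0).
(* With this slope, one interval is shorter than 2 * C / K < d / 2, and a total
   length d / 2 makes F vary by K * (d / 2) > 1. *)
pose n := Num.Def.archi_bound ((4 * C + 2) / d).
exists n; set K : R := n%:R.
have Kd : 4 * C + 2 < K * d.
  rewrite -ltr_pdivrMr// /K /n; apply: archi_boundP.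
  by rewrite divr_ge0// ?(ltW d0)// addr_ge0// mulr_ge0.
have K0 : 0 < K by have : 0 < K * d by [lra]; rewrite pmulr_lgt0.
have [z zP] : {z : R -> R & forall x, z x != x /\
    (steep F K x -> K * `|z x - x| < `|F (z x) - F x|)}.
  apply: (@choice _ _ (fun x z => z != x /\
    (steep F K x -> K * `|z - x| < `|F z - F x|))) => x.
  have [[z h]|h] := pselect (steep F K x).
    exists z; split => //; apply: contraTneq h => ->.
    by rewrite !subrr normr0 mulr0 ltxx.
  by exists (x + 1); split => //; rewrite gt_eqF// ltrDl.
(* The radius 2 * l x leaves room for the closed interval between x and z x
   inside the open ball. *)
pose l x := `|z x - x|.
have l0 x : 0 < l x by rewrite normr_gt0 subr_eq0; case: (zP x).
pose B x := ball x (2 * l x).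
have Bball i : is_ball (B i) by exact: is_ball_ball.
have B0 i : B i !=set0 by exists i; apply: ballxx; rewrite mulr_gt0.
have lst x : steep F K x -> l x < d / 2.
  move=> /(zP x).2; rewrite -/(l x) => h.
  have := ler_normB (F (z x)) (F x); have := FC (z x); have := FC x.
  move=> h1 h2 h3; rewrite -(ltr_pM2l K0); lra.
pose pr x : R * R := (Num.min x (z x), Num.max x (z x)).
have prB x m : (pr x).1 <= m <= (pr x).2 -> B x m.
  have := l0 x; rewrite /pr /B /ball/= /l ltr_norml.
  case: (leP x (z x)) => xz + /andP[h1 h2].
    by rewrite ger0_norm ?subr_ge0//; lra.
  by rewrite ltr0_norm ?subr_lt0//; lra.
have pr12 x : (pr x).1 <= (pr x).2 by rewrite /pr/= ge_min !le_max !lexx.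
have prl x : (pr x).2 - (pr x).1 = l x.
  rewrite /pr /l/=; case: leP => xz; first by rewrite ger0_norm ?subr_ge0.
  by rewrite ltr0_norm ?subr_lt0// opprB.
have prF x : `|F (pr x).2 - F (pr x).1| = `|F (z x) - F x|.
  by rewrite /pr/=; case: leP => // _; rewrite distrC.
have fam s : uniq s -> {subset s <= steep F K} -> trivIset [set` s] B ->
    \sum_(x <- s) l x < d / 2.
  move=> us sst tB; rewrite ltNge; apply/negP => hs.
  have [|k /andP[k1 k2]] := partial_sum_between d0 _ hs.
    by move=> x /sst; rewrite inE => /lst.
  pose s' := take k s.
  have s's x : x \in s' -> x \in s by exact: mem_take.
  have := H (map pr s'); rewrite !big_map.
  rewrite (eq_bigr _ (fun x _ => prl x)) => /(_ _ (lt_le_trans k2 dd1)).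
  rewrite (eq_bigr _ (fun x _ => prF x)) => Hs'.
  have {Hs'} : \sum_(x <- s') `|F (z x) - F x| < 1.
    apply: Hs'; apply/andP; split.
      by apply/allP => p /mapP[x _ ->].
    rewrite pairwise_map.
    have : uniq s' by exact: take_uniq.
    rewrite uniq_pairwise; apply: sub_in_pairwise (allss s') => x y xs ys /= xy.
    rewrite -[_ || _]negbK; apply/negP; rewrite negb_or -!ltNge => /andP[h1 h2].
    pose m := Num.max (pr x).1 (pr y).1.
    have Bx : B x m.
      by apply: prB; rewrite /m le_max lexx/= ge_max pr12/= ltW.
    have By : B y m.
      by apply: prB; rewrite /m le_max lexx orbT/= ge_max pr12/= ltW.
    move: xy => /eqP; apply; apply: (tB x y); rewrite /=; do ?exact: s's.
    by exists m.
  apply/negP; rewrite -leNgt.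
  apply: (@le_trans _ _ (\sum_(x <- s') K * l x)).
    rewrite -mulr_sumr; have : K * (d / 2) <= K * \sum_(x <- s') l x.
      by rewrite ler_wpM2l// ltW.
    lra.
  rewrite big_seq [leRHS]big_seq; apply: ler_sum => x /s's /sst.
  by rewrite inE => /(zP x).2/ltW.
rewrite lebesgue_regularity_inner_sup; last first.
  by apply: open_measurable; apply: open_steep; exact: ac_line_continuous.
apply: ge_ereal_sup => _ /= [Q [cQ QU] <-].
have [D DU QD] : finite_subset_cover (steep F K) B Q.
  move: cQ; rewrite compact_cover; apply.
    by move=> x _; exact: ball_open.
  by move=> x /QU xU; exists x => //; apply: ballxx; rewrite mulr_gt0.
have QDB : Q `<=` cover [set` D] B by apply: (subset_trans QD) => x [r Dr] rx; exists r.
have [E [uE ED tEB DE]] := @vitali_lemma_finite_cover _ _ B Bball B0 D.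
apply: (@le_trans _ _ (3%:E * \sum_(i <- E) lebesgue_measure (B i))%E).
  have {}DE := subset_trans QDB DE.
  apply: (le_trans (@content_subadditive _ _ _ lebesgue_measure Q
      (fun i => scale_ball 3 (B (nth 0 E i))) (size E) _ _ _)) => //.
  - by move=> k ?; rewrite scale_ballE//; exact: measurable_ball.
  - exact: compact_measurable.
  - by apply: (subset_trans DE); rewrite /cover bigcup_seq (big_nth 0)//= big_mkord.
  - rewrite ge0_sume_distrr//= (big_nth 0) big_mkord; apply: lee_sum => i _.
    rewrite scale_ballE// !lebesgue_measure_ball ?mulr_ge0 ?(ltW (l0 _))//.
    by rewrite -mulrnAr EFinM.
rewrite (eq_bigr (fun x => (4 * l x)%:E)); last first.
  move=> x _; rewrite /B lebesgue_measure_ball ?mulr_ge0 ?(ltW (l0 _))//.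
  by congr (_%:E); rewrite -mulr_natr; ring.
rewrite sumEFin -EFinM lee_fin -mulr_sumr.
have := fam E uE _ tEB; rewrite -/K => h.
have {}h : \sum_(x <- E) l x < d / 2.
  by apply: h => x /ED /DU.
lra.
Qed.

Lemma steep_null (R : realType) (F : R -> R) (C : R) :
  ac_line F -> (forall x, `|F x| <= C) ->
  (@lebesgue_measure R).-negligible (\bigcap_n steep F n%:R).
Proof.
move=> acF FC; exists (\bigcap_n steep F n%:R).
have mS : measurable (\bigcap_n steep F n%:R : set (measurableTypeR R)).
  apply: bigcap_measurable => // n _; apply: open_measurable.
  by apply: open_steep; exact: ac_line_continuous.
split => //; apply/eqP; rewrite -measure_le0; apply/lee_addgt0Pr => e e0.
rewrite add0e; have [n ne] := steep_small acF FC e0.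
apply: le_trans ne; apply: le_measure; rewrite ?inE//.
  by apply: open_measurable; apply: open_steep; exact: ac_line_continuous.
exact: bigcap_inf.
Qed.

(** The function [U x = sup_z (F z - K |z - x|)] is the least [K]-Lipschitz
    function above [F]; at a point that is not steep, the supremum is attained
    at [z = x]. *)
Lemma upper_envelope (R : realType) (F : R -> R) (C K : R) :
  0 <= K -> (forall x, `|F x| <= C) ->
  exists U : R -> R, [/\ forall x y, `|U x - U y| <= K * `|x - y|,
    forall x, F x <= U x & forall x, ~ steep F K x -> U x = F x].
Proof.
move=> K0 FC; pose S x := [set F z - K * `|z - x| | z in [set: R]].
have S0 x : S x !=set0 by exists (F x - K * `|x - x|), x.
have SC x : has_ubound (S x).
  exists C => _ [z _ <-]; rewrite lerBlDr; apply: (le_trans (ler_norm _)).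
  by apply: (le_trans (FC z)); rewrite lerDl mulr_ge0.
have lip x y : sup (S x) - sup (S y) <= K * `|x - y|.
  rewrite lerBlDr; apply: ge_sup => // _ [z _ <-].
  have zy : F z - K * `|z - y| <= sup (S y) by apply: ub_le_sup => //; exists z.
  have : K * `|z - y| <= K * (`|z - x| + `|x - y|) by rewrite ler_wpM2l// ler_distD.
  lra.
have FS x : F x <= sup (S x).
  by apply: ub_le_sup => //; exists x => //; rewrite subrr normr0 mulr0 subr0.
exists (fun x => sup (S x)); split => //.
  by move=> x y; rewrite ler_norml lip andbT lerNl opprB distrC lip.
move=> x nst; apply/le_anti; rewrite FS andbT; apply: ge_sup => // _ [z _ <-].
rewrite leNgt; apply/negP => h; apply: nst; exists z.
by apply: lt_le_trans (ler_norm _); lra.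
Qed.

(** Outside of a null set, [x] is not steep for some integer [n], hence [F] is
    squeezed at [x] between its two [n]-Lipschitz envelopes. *)
Lemma ac_line_ae_derivable (R : realType) (A B C : R) (F : R -> R) :
  ac_line F -> (forall x, `|F x| <= C) ->
  {ae @lebesgue_measure R, forall x, A < x < B -> derivable F x 1}.
Proof.
move=> acF FC.
have FCN x : `|(\- F) x| <= C by rewrite /= normrN.
have env n : exists LU : (R -> R) * (R -> R), [/\
    forall x y, `|LU.1 x - LU.1 y| <= n%:R * `|x - y|,
    forall x y, `|LU.2 x - LU.2 y| <= n%:R * `|x - y|,
    forall x, LU.1 x <= F x <= LU.2 x &
    forall x, ~ steep F n%:R x -> LU.1 x = F x /\ LU.2 x = F x].
  have [U [U1 U2 U3]] := upper_envelope (ler0n R n) FC.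
  have [L [L1 L2 L3]] := upper_envelope (ler0n R n) FCN.
  exists (\- L, U); split => //=.
  - by move=> x y; rewrite -opprD normrN L1.
  - by move=> x; rewrite U2 andbT lerNl; exact: L2.
  - move=> x nst; rewrite U3// L3/= ?opprK//.
    by move=> [z hz]; apply: nst; exists z; move: hz; rewrite /= -opprD normrN.
have [LU LUP] := choice env.
have ae1 : {ae @lebesgue_measure R, forall x, forall n, A < x < B ->
    derivable (LU n).1 x 1 /\ derivable (LU n).2 x 1}.
  apply/ae_foralln => n; have [L1 L2 _ _] := LUP n.
  have h1 := @lipschitz_ae_derivable _ A B _ _ L1.
  have h2 := @lipschitz_ae_derivable _ A B _ _ L2.
  by apply: ae_imply2 h1 h2 => x /= d1 d2 AxB; split; [exact: d1|exact: d2].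
have ae2 : {ae @lebesgue_measure R, forall x, ~ (\bigcap_n steep F n%:R) x}.
  by apply: negligibleS (steep_null acF FC) => x /= /contrapT.
apply: ae_imply2 ae1 ae2 => x /= d nst AxB.
have [n nstn] : exists n, ~ steep F n%:R x.
  by apply/existsNP => h; apply: nst => n _; exact: h.
have [_ _ LFU /(_ _ nstn)[Lx Ux]] := LUP n.
have [dL dU] := d n AxB.
exact: (derivable_squeeze dL dU).
Qed.

(** * Calculus of absolutely continuous functions on a segment *)

Lemma ac_bounded (R : realType) (A B : R) (f : R -> R) : A <= B ->
  absolutely_continuous A B f -> exists C, forall x, A <= x <= B -> `|f x| <= C.
Proof.
move=> AB acf; pose F := f \o clamp A B.
have cF : continuous (fun x => `|F x|).
  by move=> x; apply: cvg_norm; apply: ac_line_continuous; exact: ac_line_clamp.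
have [c _ cP] : exists2 c, c \in `[A, B]%R & forall t, t \in `[A, B]%R -> `|F t| <= `|F c|.
  by apply: EVT_max => //; apply: continuous_subspaceT.
exists `|F c| => x AxB; have := cP x; rewrite in_itv/= AxB => /(_ isT).
by rewrite /F/= clamp_id.
Qed.

Lemma clamp_near (R : realType) (A B x : R) (f : R -> R) : A < x < B ->
  {near x, f \o clamp A B =1 f}.
Proof.
move=> /andP[Ax xB]; near=> y; rewrite /= clamp_id//; apply/andP; split; apply: ltW; near: y.
  exact: lt_nbhsr.
exact: lt_nbhsl.
Unshelve. all: by end_near. Qed.

Lemma ac_ae_derivable (R : realType) (A B : R) (f : R -> R) : A <= B ->
  absolutely_continuous A B f ->
  {ae @lebesgue_measure R, forall x, A < x < B -> derivable f x 1}.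
Proof.
move=> AB acf; have [C fC] := ac_bounded AB acf.
have FC x : `|(f \o clamp A B) x| <= C by apply: fC; exact: clamp_in.
have h := @ac_line_ae_derivable _ A B _ _ (ac_line_clamp AB acf) FC.
apply: (ae_imply2 _ h h) => x dx _ AxB.
exact: near_eq_derivable (clamp_near f AxB) (dx AxB).
Qed.

Lemma ac_nonincreasing (R : realType) (A B : R) (f : R -> R) : A <= B ->
  absolutely_continuous A B f ->
  {ae @lebesgue_measure R,
    forall x, A < x < B -> derivable f x 1 -> 'D_1 f x <= 0} ->
  f B <= f A.
Proof.
move=> AB acf df0.
have := @ac_line_le _ A B (f \o clamp A B) AB (ac_line_clamp AB acf).
rewrite /= !clamp_id ?lexx ?AB//; apply.
apply: ae_imply2 (ac_ae_derivable AB acf) df0 => x df df0 AxB.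
have dfx := df AxB; have nf := clamp_near f AxB.
have nf' : {near x, f =1 f \o clamp A B} by apply: filterS nf => y ->.
split; first exact: near_eq_derivable nf' dfx.
by rewrite (near_eq_derive _ nf)//; exact: df0.
Qed.

Lemma acS (R : realType) (V : normedModType R) (A B A' B' : R) (f : R -> V) :
  A <= A' -> B' <= B -> absolutely_continuous A B f -> absolutely_continuous A' B' f.
Proof.
move=> AA BB acf e /acf[d d0 H]; exists d => // n p q pq dj; apply: H => // i.
by have [h1 h2 h3] := pq i; split => //; [exact: le_trans h1|exact: le_trans BB].
Qed.

Lemma ac_dominated (R : realType) (V W : normedModType R) (A B : R)
    (f : R -> V) (g : R -> W) (C : R) :
  (forall p q, A <= p -> p <= q -> q <= B -> `|g q - g p| <= C * `|f q - f p|) ->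
  absolutely_continuous A B f -> absolutely_continuous A B g.
Proof.
move=> H acf e e0; have C0 : 0 < `|C| + 1 by rewrite ltr_wpDl.
have [d d0 {}acf] := acf (e / (`|C| + 1)) (divr_gt0 e0 C0); exists d => // n p q pq dj sd.
have := acf n p q pq dj sd; rewrite ltr_pdivlMr// mulr_suml; apply: le_lt_trans.
apply: ler_sum => i _; have [h1 h2 h3] := pq i.
apply: (le_trans (H _ _ h1 (ltW h2) h3)); rewrite mulrC ler_wpM2l//.
by rewrite (le_trans (ler_norm _))// lerDl.
Qed.

Lemma ac_cst (R : realType) (A B k : R) : absolutely_continuous A B (cst k : R -> R).
Proof.
move=> e e0; exists 1 => // n p q _ _ _.
by rewrite big1// => i _; rewrite subrr normr0.
Qed.

Lemma ac_id (R : realType) (A B : R) : absolutely_continuous A B (id : R -> R).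
Proof.
move=> e e0; exists e => // n p q pq _; apply: le_lt_trans; apply: ler_sum => i _.
by have [_ h _] := pq i; rewrite ger0_norm// subr_ge0 ltW.
Qed.

Lemma acD (R : realType) (A B : R) (f g : R -> R) :
  absolutely_continuous A B f -> absolutely_continuous A B g ->
  absolutely_continuous A B (f + g).
Proof.
move=> acf acg e e0; have e2 : 0 < e / 2 by rewrite divr_gt0.
have [d1 d10 h1] := acf _ e2; have [d2 d20 h2] := acg _ e2.
exists (Num.min d1 d2); first by rewrite lt_min d10.
move=> n p q pq dj; rewrite lt_min => /andP[sd1 sd2].
have := h1 n p q pq dj sd1; have := h2 n p q pq dj sd2 => H2 H1.
rewrite [e]splitr; apply: le_lt_trans (ltrD H1 H2); rewrite -big_split/=.
apply: ler_sum => i _; rewrite !fctE.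
by rewrite (_ : _ - _ = (f (q i) - f (p i)) + (g (q i) - g (p i))) ?ler_normD//; ring.
Qed.

Lemma acM (R : realType) (A B : R) (f g : R -> R) : A <= B ->
  absolutely_continuous A B f -> absolutely_continuous A B g ->
  absolutely_continuous A B (f * g).
Proof.
move=> AB acf acg; have [C1 fC] := ac_bounded AB acf.
have [C2 gC] := ac_bounded AB acg => e e0.
have C10 : 0 <= C1 by rewrite (le_trans _ (fC A _))// lexx.
have C20 : 0 <= C2 by rewrite (le_trans _ (gC A _))// lexx.
pose C := C1 + C2 + 1; have C0 : 0 < C by rewrite /C; lra.
have e2 : 0 < e / (2 * C) by rewrite divr_gt0// mulr_gt0.
have [d1 d10 h1] := acf _ e2; have [d2 d20 h2] := acg _ e2.
exists (Num.min d1 d2); first by rewrite lt_min d10.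
move=> n p q pq dj; rewrite lt_min => /andP[sd1 sd2].
have := h1 n p q pq dj sd1; have := h2 n p q pq dj sd2 => H2 H1.
have -> : e = C * (e / (2 * C) + e / (2 * C)) by field; lra.
rewrite -ltr_pdivrMl//; apply: le_lt_trans (ltrD H1 H2).
rewrite ler_pdivrMl// -big_split/= mulr_sumr; apply: ler_sum => i _.
have [h3 h4 h5] := pq i; rewrite !fctE.
have fq : `|f (q i)| <= C1 by apply: fC; rewrite h5 andbT (le_trans h3)// ltW.
have gp : `|g (p i)| <= C2 by apply: gC; rewrite h3 (le_trans (ltW h4)).
rewrite (_ : _ - _ = f (q i) * (g (q i) - g (p i)) + g (p i) * (f (q i) - f (p i)));
  last by ring.
apply: (le_trans (ler_normD _ _)); rewrite !normrM mulrDr addrC.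
by apply: lerD; apply: ler_wpM2r => //; rewrite /C; lra.
Qed.

Lemma ac_cont (R : realType) (A B x e : R) (f : R -> R) :
  absolutely_continuous A B f -> A <= x <= B -> 0 < e ->
  exists2 d, 0 < d & forall y, A <= y <= B -> `|y - x| < d -> `|f y - f x| < e.
Proof.
move=> acf AxB e0; have AB : A <= B by case/andP: AxB => /le_trans h /h.
have /cvgrPdist_lt/(_ _ e0)[d/= d0 H] := ac_line_continuous (ac_line_clamp AB acf) (x := x).
exists d => // y AyB yx; have := H y; rewrite /ball/= !clamp_id//.
by rewrite (distrC x) (distrC (f x)); exact.
Qed.

Lemma ac_growth (R : realType) (A B k : R) (f : R -> R) : A <= B ->
  absolutely_continuous A B f ->
  {ae @lebesgue_measure R,
    forall x, A < x < B -> derivable f x 1 -> 'D_1 f x <= k} ->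
  f B - f A <= k * (B - A).
Proof.
move=> AB acf df.
have acg : absolutely_continuous A B (f + cst (- k) * id).
  by apply: acD => //; apply: acM => //; [exact: ac_cst|exact: ac_id].
have : (f + cst (- k) * id) B <= (f + cst (- k) * id) A.
  apply: (ac_nonincreasing AB acg).
  apply: ae_imply2 df (ac_ae_derivable AB acf) => x dfk dfx AxB _.
  have dx := dfx AxB.
  have dg : is_derive x 1 (cst (- k) * id : R -> R) (- k).
    apply: (is_derive_eq (is_derive_scale (- k) (@is_derive_id _ _ x 1))).
    by rewrite mulr1.
  have [dg1 dgE] := dg.
  by rewrite deriveD// dgE subr_le0 dfk.
rewrite !fctE; lra.
Qed.

Lemma ac_lipschitz (R : realType) (A B k : R) (f : R -> R) : A <= B ->
  absolutely_continuous A B f ->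
  {ae @lebesgue_measure R,
    forall x, A < x < B -> derivable f x 1 -> `|'D_1 f x| <= k} ->
  `|f B - f A| <= k * (B - A).
Proof.
move=> AB acf df; rewrite ler_norml; apply/andP; split; last first.
  apply: ac_growth => //; apply: ae_imply df => x h AxB dx.
  by apply: le_trans (h AxB dx); exact: ler_norm.
have acN : absolutely_continuous A B (- f).
  by apply: (@ac_dominated _ _ _ _ _ _ _ 1 _ acf) => p q _ _ _; rewrite mul1r !fctE -opprD normrN.
rewrite lerNl opprB; apply: (le_trans _ (ac_growth AB acN _)).
  by rewrite !fctE opprK addrC.
apply: ae_imply2 df (ac_ae_derivable AB acf) => x h dfx AxB _.
have dx := dfx AxB; rewrite deriveN//; apply: le_trans (h AxB dx).
by rewrite -normrN ler_norm.
Qed.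

Lemma ac_le_closed (R : realType) (p q t k : R) (f : R -> R) :
  absolutely_continuous p q f -> p <= t <= q ->
  (forall d, 0 < d -> exists r, [/\ p <= r <= q, `|r - t| < d & f r <= k]) ->
  f t <= k.
Proof.
move=> acf ptq H; rewrite leNgt; apply/negP => kft.
have k0 : 0 < f t - k by rewrite subr_gt0.
have [d d0 hd] := ac_cont acf ptq k0.
have [r [prq rt frk]] := H _ d0.
by have := hd _ prq rt; rewrite ltr_norml => /andP[]; lra.
Qed.

Lemma first_exit (R : realType) (p q k : R) (f : R -> R) : p <= q ->
  absolutely_continuous p q f -> f p <= k -> k < f q ->
  exists t0, [/\ p <= t0 < q, forall r, p <= r <= t0 -> f r <= k, f t0 = k &
    forall d, 0 < d -> exists r, [/\ t0 < r <= q, r < t0 + d & k < f r]].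
Proof.
move=> pq acf fp fq.
pose E := [set t | p <= t <= q /\ forall r, p <= r <= t -> f r <= k].
have Ep : E p.
  split; first by rewrite lexx pq.
  by move=> r /andP[h1 h2]; have -> : r = p by apply/le_anti; rewrite h1 h2.
have supE : has_sup E by split; [exists p|exists q => t [/andP[]]].
have pt0 : p <= sup E by exact: ub_le_sup supE.2 _ Ep.
have t0q : sup E <= q by apply: ge_sup; [exists p|move=> t [/andP[]]].
have below r : p <= r -> r < sup E -> f r <= k.
  move=> pr rE; have sr : 0 < sup E - r by rewrite subr_gt0.
  have [t [_ Et]] := sup_adherent sr supE; rewrite subKr => rt.
  by apply: Et; rewrite pr ltW.
have ft0 : f (sup E) <= k.
  move: pt0; rewrite le_eqVlt => /predU1P[<-//|pt0].
  apply: (ac_le_closed acf); first by rewrite ltW.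
  move=> d d0; pose r := Num.max p (sup E - d / 2).
  have rE : r < sup E by rewrite /r gt_max pt0/=; lra.
  have pr : p <= r by rewrite /r le_max lexx.
  have dr : sup E - d / 2 <= r by rewrite /r le_max lexx orbT.
  exists r; split; last exact: below.
    by rewrite pr/= (le_trans (ltW rE)).
  by rewrite ltr_norml; apply/andP; split; lra.
have le_t0 r : p <= r <= sup E -> f r <= k.
  by move=> /andP[pr]; rewrite le_eqVlt => /predU1P[->//|]; exact: below.
have t0q' : sup E < q.
  by rewrite lt_neqAle t0q andbT; apply: contraTneq fq => <-; rewrite -leNgt.
have past d : 0 < d -> exists r, [/\ sup E < r <= q, r < sup E + d & k < f r].
  move=> d0; apply: contrapT => H.
  pose t := Num.min q (sup E + d / 2).
  have Et : sup E < t by rewrite /t lt_min t0q'/=; lra.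
  have tq : t <= q by rewrite /t ge_min lexx.
  have td : t <= sup E + d / 2 by rewrite /t ge_min lexx orbT.
  have : E t.
    split; first by rewrite tq (le_trans pt0)// ltW.
    move=> r /andP[pr rt]; have [rE|Er] := leP r (sup E).
      by apply: le_t0; rewrite pr.
    rewrite leNgt; apply/negP => kfr; apply: H; exists r; split => //.
      by rewrite Er (le_trans rt).
    lra.
  by move=> /(ub_le_sup supE.2); rewrite leNgt Et.
exists (sup E); split => //; first by rewrite pt0.
apply/le_anti; rewrite ft0/=.
have Nf : absolutely_continuous p q (fun t => - f t).
  by apply: (@ac_dominated _ _ _ _ _ _ _ 1 _ acf) => u v _ _ _; rewrite mul1r -opprD normrN.
rewrite -lerN2; apply: (ac_le_closed Nf); first by rewrite pt0.
move=> d d0; have [r [/andP[Er rq] rd kr]] := past d d0; exists r; split.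
- by rewrite rq (le_trans pt0)// ltW.
- by rewrite gtr0_norm ?subr_gt0// ltrBlDl.
- by rewrite lerN2 ltW.
Qed.

Lemma last_le (R : realType) (p q k : R) (f : R -> R) : p <= q ->
  absolutely_continuous p q f -> f p <= k -> k < f q ->
  exists t0, [/\ p <= t0 < q, f t0 <= k & forall r, t0 < r <= q -> k < f r].
Proof.
move=> pq acf fp fq.
pose E := [set t | p <= t <= q /\ f t <= k].
have Ep : E p by split; first by rewrite lexx pq.
have supE : has_sup E by split; [exists p|exists q => t [/andP[]]].
have pt0 : p <= sup E by exact: ub_le_sup supE.2 _ Ep.
have t0q : sup E <= q by apply: ge_sup; [exists p|move=> t [/andP[]]].
have ft0 : f (sup E) <= k.
  apply: (ac_le_closed acf); first by rewrite pt0.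
  move=> d d0; have [t Et dt] := sup_adherent d0 supE.
  have tE := ub_le_sup supE.2 Et; case: Et => ptq ft.
  exists t; split => //.
  by rewrite ltr_norml; apply/andP; split; lra.
exists (sup E); split => //.
  rewrite pt0 lt_neqAle t0q andbT; apply: contraTneq fq => <-.
  by rewrite -leNgt.
move=> r /andP[Er rq]; rewrite ltNge; apply/negP => frk.
have : E r by split => //; rewrite rq (le_trans pt0)// ltW.
by move=> /(ub_le_sup supE.2); rewrite leNgt Er.
Qed.

(** * Asymptotics on a half-line *)

Definition bounded_after (R : realType) (tau : R) (f : R -> R) : Prop :=
  exists C, forall t, tau <= t -> `|f t| <= C.

Definition lipschitz_after (R : realType) (tau : R) (f : R -> R) : Prop :=
  exists L, forall t t', tau <= t -> t <= t' -> `|f t' - f t| <= L * (t' - t).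

Definition vanishes (R : realType) (f : R -> R) : Prop :=
  forall e : R, 0 < e -> exists T, forall t, T <= t -> `|f t| < e.

Lemma bounded_after_cst (R : realType) (tau k : R) : bounded_after tau (cst k).
Proof. by exists `|k|. Qed.

Lemma bounded_afterD (R : realType) (tau : R) (f g : R -> R) :
  bounded_after tau f -> bounded_after tau g -> bounded_after tau (f + g).
Proof.
move=> [C fC] [D gD]; exists (C + D) => t taut; rewrite !fctE.
by apply: (le_trans (ler_normD _ _)); apply: lerD; [exact: fC|exact: gD].
Qed.

Lemma bounded_afterM (R : realType) (tau : R) (f g : R -> R) :
  bounded_after tau f -> bounded_after tau g -> bounded_after tau (f * g).
Proof.
move=> [C fC] [D gD]; exists (C * D) => t taut; rewrite !fctE normrM.
by apply: ler_pM => //; [exact: fC|exact: gD].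
Qed.

Lemma lipschitz_after_cst (R : realType) (tau k : R) : lipschitz_after tau (cst k).
Proof. by exists 0 => t t' _ _; rewrite subrr normr0 mul0r. Qed.

Lemma lipschitz_afterD (R : realType) (tau : R) (f g : R -> R) :
  lipschitz_after tau f -> lipschitz_after tau g -> lipschitz_after tau (f + g).
Proof.
move=> [C fC] [D gD]; exists (C + D) => t t' taut tt'; rewrite !fctE.
rewrite (_ : _ - _ = (f t' - f t) + (g t' - g t)); last by ring.
by rewrite mulrDl (le_trans (ler_normD _ _))// lerD ?fC ?gD.
Qed.

Lemma lipschitz_afterM (R : realType) (tau : R) (f g : R -> R) :
  bounded_after tau f -> bounded_after tau g ->
  lipschitz_after tau f -> lipschitz_after tau g -> lipschitz_after tau (f * g).
Proof.
move=> [C fC] [D gD] [K fK] [L gL]; exists (C * L + D * K) => t t' taut tt'.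
rewrite !fctE (_ : _ - _ = f t' * (g t' - g t) + g t * (f t' - f t)); last by ring.
rewrite mulrDl -!mulrA (le_trans (ler_normD _ _))// !normrM lerD//.
  by apply: ler_pM => //; [apply: fC; exact: le_trans tt'|exact: gL].
by apply: ler_pM => //; [exact: gD|exact: fK].
Qed.

(** A Cauchy condition at infinity, stated for decrements since this is the form
    in which [barbalat_inequality] consumes it. *)
Lemma bounded_monotone_gap (R : realType) (tau : R) (f : R -> R) :
  bounded_after tau f -> (forall t t', tau <= t -> t <= t' -> f t' <= f t) ->
  forall e, 0 < e -> exists T, forall t t', T <= t -> t <= t' -> f t - f t' < e.
Proof.
move=> [C fC] f_dec e e0; pose E := [set f t | t in [set t | tau <= t]].
have infE : has_inf E.
  split; first by exists (f tau), tau => //=.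
  by exists (- C) => _ [t /fC + <-]; rewrite ler_norml => /andP[].
have [_ [T /= tauT <-] fT] := inf_adherent e0 infE.
exists T => t t' Tt tt'.
have h1 := f_dec _ _ tauT Tt.
have h2 : inf E <= f t'.
  by apply: ge_inf; [exact: infE.2|exists t' => //=; apply: le_trans tt'; exact: le_trans Tt].
lra.
Qed.

Lemma ac_lipschitz_after (R : realType) (tau : R) (f h : R -> R) :
  (forall T, tau < T -> absolutely_continuous tau T f) ->
  bounded_after tau h ->
  (forall T, tau < T -> {ae @lebesgue_measure R, forall t, tau < t < T ->
    derivable f t 1 -> `|'D_1 f t| <= `|h t|}) ->
  lipschitz_after tau f.
Proof.
move=> acf [C hC] df; exists C => t t' taut.
rewrite le_eqVlt => /predU1P[->|tt']; first by rewrite !subrr normr0 mulr0.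
have taut' : tau < t' by exact: le_lt_trans tt'.
apply: ac_lipschitz; [exact: ltW|exact: acS (acf _ taut')|].
apply: ae_imply (df _ taut') => r hr /andP[tr rt'] dr.
have taur : tau < r by exact: le_lt_trans tr.
by apply: (le_trans (hr _ dr)); rewrite ?taur//; apply: hC; exact: ltW.
Qed.

Lemma vanishes_cvg (R : realType) (f : R -> R) (l : R) :
  vanishes (fun t => f t - l) -> f t @[t --> +oo] --> l.
Proof.
move=> vf; apply/cvgrPdist_lt => e /vf[T HT]; near=> t.
by rewrite distrC; apply: HT; near: t; apply: nbhs_pinfty_ge; exact: num_real.
Unshelve. all: by end_near. Qed.

(** If [g t >= e] then, [g] being Lipschitz, [g >= e / 2] on an interval of fixed
    length [d] after [t], over which [f] loses at least [e / 2 * d]; such losses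
    cannot occur at arbitrarily late times. *)
Lemma barbalat_inequality (R : realType) (f g : R -> R) (L tau e : R) :
  (forall T, tau < T -> absolutely_continuous tau T f) ->
  (forall T, tau < T -> {ae @lebesgue_measure R,
     forall t, tau < t < T -> derivable f t 1 -> 'D_1 f t <= - g t}) ->
  (forall t t', tau <= t -> t <= t' -> `|g t' - g t| <= L * (t' - t)) ->
  (forall e, 0 < e -> exists T, forall t t', T <= t -> t <= t' -> f t - f t' < e) ->
  0 < e -> exists T, forall t, T <= t -> g t < e.
Proof.
move=> acf df gL fC e0.
(* On this length g loses at most e / 2, even when L <= 0. *)
pose d := e / (2 * (`|L| + 1)).
have L0 : 0 < `|L| + 1 by rewrite ltr_wpDl.
have d0 : 0 < d by rewrite /d divr_gt0// mulr_gt0.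
have [T HT] := fC (e / 2 * d) (mulr_gt0 (divr_gt0 e0 (ltr0n _ 2)) d0).
exists (Num.max T (tau + 1)) => t; rewrite ge_max => /andP[Tt taut].
rewrite ltNge; apply/negP => egt.
have := HT t (t + d) Tt; rewrite lerDl (ltW d0) => /(_ isT).
have tt' : t <= t + d by rewrite lerDl ltW.
have tau_lt : tau < t + d by lra.
have acd : absolutely_continuous t (t + d) f by apply: acS (acf _ tau_lt) => //; lra.
have : f (t + d) - f t <= - (e / 2) * (t + d - t).
  apply: ac_growth => //; apply: ae_imply (df _ tau_lt) => x h /andP[tx xtd] dx.
  have := h _ dx; rewrite xtd andbT (lt_trans _ tx)//; last by lra.
  move=> /(_ isT) /le_trans; apply; rewrite lerN2.
  have := gL t x; rewrite (ltW tx) => /(_ _ isT).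
  have -> : tau <= t by lra.
  move=> /(_ isT); rewrite ler_norml => /andP[gx _].
  have : L * (x - t) <= e / 2.
    have xtd' : x - t <= d by lra.
    apply: (@le_trans _ _ ((`|L| + 1) * d)).
      apply: (@le_trans _ _ ((`|L| + 1) * (x - t))).
        by rewrite ler_wpM2r ?subr_ge0 ?(ltW tx)// (le_trans (ler_norm L))// lerDl.
      by rewrite ler_wpM2l// ltW.
    by rewrite /d le_eqVlt; apply/orP; left; apply/eqP; field; rewrite gt_eqF.
  lra.
by rewrite addrAC subrr add0r; lra.
Qed.

(** * The drilling system in energy coordinates *)

Definition restoring (R : realType) (a c g s : R) : R := c * g - a * s + g / c * s ^+ 2.

(** The primitive of [- restoring] that vanishes at 0. *)
Definition potential (R : realType) (a c g s : R) : R :=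
  a / 2 * s ^+ 2 - g / (3 * c) * s ^+ 3 - c * g * s.

Definition energy (R : realType) (a c g s e z : R) : R :=
  e ^+ 2 / 2 + a ^+ 2 / 2 * z ^+ 2 + potential a c g s.

Definition dissipation (R : realType) (a c g e z : R) : R :=
  c * (1 - g / (2 * c ^+ 2)) * (e ^+ 2 + (a * z) ^+ 2).

(** The values of s' that the inclusion allows, in terms of e.  On the
    discontinuity, the upper bound gives [e >= 0] to a sliding motion. *)
Definition admissible_velocity (R : realType) (c M g s e : R) : set R :=
  [set w | [/\ s < c -> w = e, s = c -> w <= e & c < s -> w = e - (M + 1) * g]].

(** Solutions in the coordinates e = a y + g and z = - x - g s / (a c), where
    the terms in e z s cancel in the derivative of the energy. *)
Definition drill_motion (R : realType) (a c M g tau : R) (s e z : R -> R) :=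
  forall T, tau < T ->
  [/\ absolutely_continuous tau T s, absolutely_continuous tau T e,
      absolutely_continuous tau T z &
  {ae @lebesgue_measure R, forall t, tau < t < T -> exists2 w,
    admissible_velocity c M g (s t) (e t) w &
    [/\ is_derive t 1 s w,
        is_derive t 1 e (- c * e t + a * z t * s t + restoring a c g (s t)) &
        is_derive t 1 z (- c * z t - e t * s t / a - g / (a * c) * w)]}].

Lemma is_derive_pair (R : realType) (V W : normedModType R) (f : R -> V)
    (g : R -> W) (t : R) (a : V) (b : W) :
  is_derive t 1 f a -> is_derive t 1 g b ->
  is_derive t 1 (fun t => (f t, g t)) (a, b).
Proof.
move=> [df <-] [dg <-].
have cv : h^-1 *: ((f (h *: (1 : R) + t), g (h *: (1 : R) + t)) - (f t, g t))
    @[h --> 0^'] --> ('D_1 f t, 'D_1 g t).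
  exact: (cvg_pair df dg).
split; first by apply/cvg_ex; exists ('D_1 f t, 'D_1 g t).
by apply: cvg_lim cv; exact: norm_hausdorff.
Qed.

Lemma solution_regular (R : realType) (a c M gamma tau T : R) (s y x : R -> R) :
  is_solution (drilling_system a c M gamma) tau (fun t => (s t, y t, x t)) ->
  tau < T ->
  [/\ absolutely_continuous tau T s, absolutely_continuous tau T y,
      absolutely_continuous tau T x &
      {ae @lebesgue_measure R, forall t, tau < t < T -> exists2 m,
        Mf_ext c M gamma (s t) m &
        [/\ is_derive t 1 s (a * y t + m),
            is_derive t 1 y (- c * y t - s t - x t * s t) &
            is_derive t 1 x (- c * x t + y t * s t)]}].
Proof.
move=> [acu Fu] tauT; have ac := acu T tauT; have leT := ltW tauT.
have acs : absolutely_continuous tau T s.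
  apply: (@ac_dominated _ _ _ _ _ _ _ 1 _ ac) => p q _ _ _.
  by rewrite mul1r !prod_normE/= !le_max lexx.
have acy : absolutely_continuous tau T y.
  apply: (@ac_dominated _ _ _ _ _ _ _ 1 _ ac) => p q _ _ _.
  by rewrite mul1r !prod_normE/= !le_max lexx ?orbT.
have acx : absolutely_continuous tau T x.
  apply: (@ac_dominated _ _ _ _ _ _ _ 1 _ ac) => p q _ _ _.
  by rewrite mul1r !prod_normE/= !le_max lexx ?orbT.
split => //.
have h := ae_imply2 (fun t h1 h2 => conj h1 h2) (ac_ae_derivable leT acs)
  (ac_ae_derivable leT acy).
apply: ae_imply2 h (ac_ae_derivable leT acx) => t [ds dy] dx tT.
have Ds := derivableP (ds tT); have Dy := derivableP (dy tT).
have Dx := derivableP (dx tT).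
have [du uE] := is_derive_pair (is_derive_pair Ds Dy) Dx.
have := Fu t (andP tT).1 du.
rewrite uE => -[m Mm [Es Ey Ex]].
by exists m; rewrite // -Es -Ey -Ex.
Qed.

Lemma solution_motion (R : realType) (a c M g tau : R) (s y x : R -> R) :
  0 < a -> 0 < c ->
  is_solution (drilling_system a c M g) tau (fun t => (s t, y t, x t)) ->
  drill_motion a c M g tau s (cst a * y + cst g)
    (cst (- 1) * x + cst (- (g / (a * c))) * s).
Proof.
move=> a0 c0 sol T tauT; have [acs acy acx h] := solution_regular sol tauT.
have aneq : a != 0 by rewrite gt_eqF.
have cneq : c != 0 by rewrite gt_eqF.
have leT := ltW tauT; have K k : absolutely_continuous tau T (cst k : R -> R) by exact: ac_cst.
split => //.
- exact: acD (acM leT (K _) acy) (K _).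
- exact: acD (acM leT (K _) acx) (acM leT (K _) acs).
apply: ae_imply h => t h tT; have [m Mm [Ds Dy Dx]] := h tT.
exists (a * y t + m).
  rewrite /admissible_velocity/= !fctE/=; move: Mm; rewrite /Mf_ext.
  case: (ltgtP (s t) c) => [sc|sc|sc] /=.
  - by move=> ->; split => //.
  - move=> ->; split => // [sce|_]; last by ring.
    by move: sc; rewrite sce ltxx.
  - by rewrite in_itv/= => /andP[_ mg]; split => // _; rewrite lerD2l.
split; first exact: Ds.
- apply: (is_derive_eq
    (is_deriveD (is_derive_scale a Dy) (is_derive_cst g t 1))).
  by rewrite /restoring !fctE /=; field; rewrite aneq cneq.
- apply: (is_derive_eq
    (is_deriveD (is_derive_scale (- 1) Dx) (is_derive_scale _ Ds))).
  by rewrite !fctE /=; field; rewrite aneq cneq.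
Qed.

(** * Decay of the energy and confinement *)

(** The difference of the two sides is [g / (2 c) * (e + a z)^2] when s' = e.
    When s' = 0 and s = c the cross term disappears, and the remaining term
    [e * restoring c] has a sign because [e >= 0] and [2 g < a]. *)
Lemma energy_rate (R : realType) (a c M g s e z w : R) :
  0 < a -> 0 < c -> 0 < g -> g < a / 2 -> g < 2 * c ^+ 2 -> s <= c ->
  admissible_velocity c M g s e w -> (s = c -> w = 0) ->
  e * (- c * e + a * z * s + restoring a c g s) +
    a ^+ 2 * z * (- c * z - e * s / a - g / (a * c) * w) - restoring a c g s * w
  <= - dissipation a c g e z.
Proof.
move=> a0 c0 g0 ga gc sc [w1 w2 _] w3.
have ca : a != 0 by rewrite gt_eqF.
have cc : c != 0 by rewrite gt_eqF.
rewrite -subr_ge0.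
move: sc; rewrite le_eqVlt => /predU1P[E|slt].
  have w0 := w3 E; have e0 := w2 E; rewrite w0 in e0 *.
  have -> : - dissipation a c g e z - (e * (- c * e + a * z * s + restoring a c g s) +
    a ^+ 2 * z * (- c * z - e * s / a - g / (a * c) * 0) - restoring a c g s * 0) =
    e * (c * (a - 2 * g)) + g / (2 * c) * (e ^+ 2 + (a * z) ^+ 2).
    by rewrite /dissipation /restoring E; field; rewrite ca cc.
  apply: addr_ge0; first by rewrite !mulr_ge0// ?(ltW c0)//; lra.
  by rewrite mulr_ge0// ?addr_ge0 ?sqr_ge0// divr_ge0 ?mulr_ge0// ltW.
rewrite w1//.
have -> : - dissipation a c g e z - (e * (- c * e + a * z * s + restoring a c g s) +
    a ^+ 2 * z * (- c * z - e * s / a - g / (a * c) * e) - restoring a c g s * e) =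
    g / (2 * c) * (e + a * z) ^+ 2.
  by rewrite /dissipation /restoring; field; rewrite ca cc.
by rewrite mulr_ge0 ?sqr_ge0// divr_ge0 ?mulr_ge0// ltW.
Qed.

(** The energy along a motion, built with pointwise operations so that the rules
    for sums and products apply to it. *)
Definition energy_fun (R : realType) (a c g : R) (s e z : R -> R) : R -> R :=
  cst 2^-1 * (e * e) + cst (a ^+ 2 / 2) * (z * z) +
  (cst (a / 2) * (s * s) + cst (- (g / (3 * c))) * (s * (s * s)) +
   cst (- (c * g)) * s).

Lemma energy_funE (R : realType) (a c g : R) (s e z : R -> R) t :
  energy_fun a c g s e z t = energy a c g (s t) (e t) (z t).
Proof. by rewrite /energy_fun /energy /potential !fctE /=; ring. Qed.

Lemma ac_energy (R : realType) (a c g p q : R) (s e z : R -> R) : p <= q ->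
  absolutely_continuous p q s -> absolutely_continuous p q e ->
  absolutely_continuous p q z ->
  absolutely_continuous p q (energy_fun a c g s e z).
Proof.
move=> pq acs ace acz.
have K k : absolutely_continuous p q (cst k : R -> R) by exact: ac_cst.
have P f h := @acM _ p q f h pq.
apply: acD (acD (P _ _ (K _) (P _ _ ace ace)) (P _ _ (K _) (P _ _ acz acz))) _.
apply: acD (acD _ _) (P _ _ (K _) acs); first exact: P _ _ (K _) (P _ _ acs acs).
exact: P _ _ (K _) (P _ _ acs (P _ _ acs acs)).
Qed.

Lemma energy_derive (R : realType) (a c g t ds de dz : R) (s e z : R -> R) :
  c != 0 -> is_derive t 1 s ds -> is_derive t 1 e de -> is_derive t 1 z dz ->
  is_derive t 1 (energy_fun a c g s e z)
    (e t * de + a ^+ 2 * z t * dz - restoring a c g (s t) * ds).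
Proof.
move=> c0 Ds De Dz.
have D1 := is_derive_scale 2^-1 (is_derive_mul De De).
have D2 := is_derive_scale (a ^+ 2 / 2) (is_derive_mul Dz Dz).
have D3 := is_derive_scale (a / 2) (is_derive_mul Ds Ds).
have D4 := is_derive_scale (- (g / (3 * c))) (is_derive_mul Ds (is_derive_mul Ds Ds)).
have D5 := is_derive_scale (- (c * g)) Ds.
apply: (is_derive_eq
  (is_deriveD (is_deriveD D1 D2) (is_deriveD (is_deriveD D3 D4) D5))).
by rewrite /restoring !fctE; field.
Qed.

(** At an interior time with s = c, a motion confined to s <= c has a local
    maximum, so it slides: s' = 0. *)
Lemma confined_motion (R : realType) (a c M g tau p q : R) (s e z : R -> R) :
  drill_motion a c M g tau s e z -> tau <= p -> p < q ->
  (forall t, p <= t <= q -> s t <= c) ->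
  {ae @lebesgue_measure R, forall t, p < t < q -> exists2 w,
    admissible_velocity c M g (s t) (e t) w /\ (s t = c -> w = 0) &
    [/\ is_derive t 1 s w,
        is_derive t 1 e (- c * e t + a * z t * s t + restoring a c g (s t)) &
        is_derive t 1 z (- c * z t - e t * s t / a - g / (a * c) * w)]}.
Proof.
move=> dm taup pq sc; have [_ _ _] := dm _ (le_lt_trans taup pq).
apply: ae_imply => t h /andP[pt tq].
have [|w wv [Ds De Dz]] := h; first by rewrite tq (le_lt_trans taup pt).
exists w; last by [].
split=> // sct; have [ds <-] := Ds.
apply: (@local_max_derive0 _ _ _ (Num.min (t - p) (q - t))) => //.
  by rewrite lt_min !subr_gt0 pt.
move=> k; rewrite sct lt_min !ltr_norml => /andP[/andP[h1 _] /andP[_ h2]].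
by apply: sc; apply/andP; split; lra.
Qed.

Lemma energy_decay (R : realType) (a c M g tau p q : R) (s e z : R -> R) :
  0 < a -> 0 < c -> 0 < g -> g < a / 2 -> g < 2 * c ^+ 2 ->
  drill_motion a c M g tau s e z -> tau <= p -> p < q ->
  (forall t, p <= t <= q -> s t <= c) ->
  {ae @lebesgue_measure R, forall t, p < t < q ->
    derivable (energy_fun a c g s e z) t 1 ->
    'D_1 (energy_fun a c g s e z) t <= - dissipation a c g (e t) (z t)}.
Proof.
move=> a0 c0 g0 ga gc dm taup pq sc.
apply: ae_imply (confined_motion dm taup pq sc) => t h ptq _.
have [w [wv w0] [Ds De Dz]] := h ptq.
have [_ ->] := energy_derive a g (lt0r_neq0 c0) Ds De Dz.
apply: energy_rate wv w0 => //.
by apply: sc; case/andP: ptq => pt tq; rewrite !ltW.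
Qed.

Lemma energy_le (R : realType) (a c M g tau p q : R) (s e z : R -> R) :
  0 < a -> 0 < c -> 0 < g -> g < a / 2 -> g < 2 * c ^+ 2 ->
  drill_motion a c M g tau s e z -> tau <= p -> p <= q ->
  (forall t, p <= t <= q -> s t <= c) ->
  energy a c g (s q) (e q) (z q) <= energy a c g (s p) (e p) (z p).
Proof.
move=> a0 c0 g0 ga gc dm taup; rewrite le_eqVlt => /predU1P[->//|pq] sc.
have [acs ace acz _] := dm _ (le_lt_trans taup pq).
rewrite -!energy_funE; apply: ac_nonincreasing; first exact: ltW.
  apply: ac_energy; first exact: ltW.
  - exact: acS acs.
  - exact: acS ace.
  - exact: acS acz.
apply: ae_imply (energy_decay a0 c0 g0 ga gc dm taup pq sc) => t h ptq dt.
apply: (le_trans (h ptq dt)); rewrite oppr_le0 /dissipation mulr_ge0//.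
  rewrite mulr_ge0 ?(ltW c0)// subr_ge0 ler_pdivrMr ?mul1r ?ltW//.
  by rewrite mulr_gt0// exprn_gt0.
by rewrite addr_ge0 ?sqr_ge0.
Qed.

(** At a first exit the energy bound forces [e < (M + 1) * g], hence s' < 0
    wherever s > c shortly afterwards.  Restarting from the last time with
    s <= c before a point with s > c then contradicts [ac_growth]. *)
Lemma no_exit (R : realType) (a c M g tau : R) (s e z : R -> R) :
  0 < a -> 0 < c -> 0 < M -> 0 < g -> g < a / 2 -> g < 2 * c ^+ 2 ->
  drill_motion a c M g tau s e z -> s tau <= c ->
  energy a c g (s tau) (e tau) (z tau) < potential a c g c + ((M + 1) * g) ^+ 2 / 2 ->
  forall t, tau <= t -> s t <= c.
Proof.
move=> a0 c0 M0 g0 ga gc dm stau V0 t1 tau_t1; rewrite leNgt; apply/negP => st1.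
have tau_lt : tau < t1.
  by rewrite lt_neqAle tau_t1 andbT; apply: contraTneq st1 => <-; rewrite -leNgt.
have [acs ace acz Hae] := dm _ tau_lt.
have [t0 [/andP[taut0 t0t1] below st0 past]] := first_exit tau_t1 acs stau st1.
have Vt0 := energy_le a0 c0 g0 ga gc dm (lexx tau) taut0 below.
have et0 : e t0 < (M + 1) * g.
  have Mg : 0 <= (M + 1) * g by rewrite mulr_ge0 ?ltW// addr_gt0.
  rewrite ltNge; apply/negP => h.
  have : ((M + 1) * g) ^+ 2 <= e t0 ^+ 2 by rewrite ler_sqr ?nnegrE// (le_trans Mg).
  have : 0 <= a ^+ 2 / 2 * z t0 ^+ 2 by rewrite mulr_ge0 ?sqr_ge0// divr_ge0 ?sqr_ge0.
  by move: Vt0 V0; rewrite {1}/energy st0; lra.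
have t0in : tau <= t0 <= t1 by rewrite taut0 ltW.
have et0' : 0 < (M + 1) * g - e t0 by rewrite subr_gt0.
have [d d0 hd] := ac_cont ace t0in et0'.
have [t2 [/andP[t02 t21] t2d st2]] := past d d0.
have acs' : absolutely_continuous t0 t2 s by exact: acS acs.
have st0c : s t0 <= c by rewrite st0.
have [t3 [/andP[t03 t32] st3 above]] := last_le (ltW t02) acs' st0c st2.
have : s t2 - s t3 <= 0 * (t2 - t3).
  apply: ac_growth; first exact: ltW.
    by apply: acS acs => //; exact: le_trans t03.
  apply: ae_imply Hae => t h /andP[t3t tt2] _.
  have taut : tau < t by apply: le_lt_trans t3t; exact: le_trans t03.
  have [|w [_ _ w3] [[_ ->] _ _]] := h; first by rewrite taut (lt_le_trans tt2).
  rewrite w3; last by apply: above; rewrite t3t ltW.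
  rewrite subr_le0.
  have := hd t; rewrite (ltW taut) (le_trans (ltW tt2) t21) => /(_ isT).
  have t0t : t0 < t by apply: le_lt_trans t3t.
  rewrite gtr0_norm ?subr_gt0// => /(_ _)/=.
  have -> : t - t0 < d by lra.
  by move=> /(_ isT); rewrite ltr_norml => /andP[_]; lra.
lra.
Qed.

Lemma norm_le_sqr (R : realType) (u k : R) : u ^+ 2 <= k -> `|u| <= k + 1.
Proof.
move=> uk; have := sqr_ge0 (`|u| - 1); rewrite sqrrB1 real_normK ?num_real// => h.
have := normr_ge0 u; lra.
Qed.

(** On s <= c, since [g < a / 2], the cubic term of the potential is at least
    [- a / 6 * s ^+ 2], which leaves a quadratic lower bound in s. *)
Lemma energy_coercive (R : realType) (a c g V0 : R) :
  0 < a -> 0 < c -> 0 < g -> g < a / 2 ->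
  exists B, forall s e z, s <= c -> energy a c g s e z <= V0 ->
    [/\ `|s| <= B, `|e| <= B & `|z| <= B].
Proof.
move=> a0 c0 g0 ga; have aneq : a != 0 by rewrite gt_eqF.
(* The constant completes the square of a / 6 * s ^+ 2 - c * g * s. *)
pose W := V0 + 3 * c ^+ 2 * g ^+ 2 / (2 * a).
pose B := 2 * W + 2 * W / a ^+ 2 + 6 * W / a + 1.
exists B => s e z sc V.
have key : e ^+ 2 / 2 + (a * z) ^+ 2 / 2 + a / 6 * s ^+ 2 <= W.
  have h1 : 0 <= s ^+ 2 * (a / 6 - g / (3 * c) * s).
    rewrite mulr_ge0 ?sqr_ge0// subr_ge0.
    apply: (@le_trans _ _ (g / (3 * c) * c)).
      by rewrite ler_wpM2l// divr_ge0 ?mulr_ge0 ?ltW.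
    have -> : g / (3 * c) * c = g / 3 by field; rewrite gt_eqF.
    lra.
  have h2 : 0 <= a / 6 * (s - 3 * c * g / a) ^+ 2.
    by rewrite mulr_ge0 ?sqr_ge0// divr_ge0 ?ltW.
  have -> : W = energy a c g s e z + (V0 - energy a c g s e z) + 3 * c ^+ 2 * g ^+ 2 / (2 * a).
    by rewrite /W; ring.
  rewrite -subr_ge0.
  rewrite (_ : _ - _ = s ^+ 2 * (a / 6 - g / (3 * c) * s) +
    a / 6 * (s - 3 * c * g / a) ^+ 2 + (V0 - energy a c g s e z)).
    by rewrite addr_ge0 ?subr_ge0// addr_ge0.
  by rewrite /energy /potential; field; rewrite aneq gt_eqF.
have e2 := sqr_ge0 e; have z2 := sqr_ge0 (a * z).
have s2 : 0 <= a / 6 * s ^+ 2 by rewrite mulr_ge0 ?sqr_ge0// divr_ge0 ?ltW.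
have W0 : 0 <= W by lra.
have W1 : 0 <= 2 * W / a ^+ 2 by rewrite divr_ge0 ?sqr_ge0// mulr_ge0.
have W2 : 0 <= 6 * W / a by rewrite divr_ge0 ?(ltW a0)// mulr_ge0.
split.
- apply: (@le_trans _ _ (6 * W / a + 1)); last by rewrite /B; lra.
  by apply: norm_le_sqr; rewrite ler_pdivlMr//; lra.
- apply: (@le_trans _ _ (2 * W + 1)); last by rewrite /B; lra.
  by apply: norm_le_sqr; lra.
- apply: (@le_trans _ _ (2 * W / a ^+ 2 + 1)); last by rewrite /B; lra.
  apply: norm_le_sqr; rewrite ler_pdivlMr ?exprn_gt0// -exprMn mulrC.
  lra.
Qed.

(** * Convergence of a confined motion *)

Section Convergence.

Context (R : realType) (a c M g tau : R) (s e z : R -> R).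

Hypotheses (a0 : 0 < a) (c0 : 0 < c) (g0 : 0 < g) (ga : g < a / 2)
  (gc : g < 2 * c ^+ 2).

Hypothesis dm : drill_motion a c M g tau s e z.

Hypothesis sc : forall t, tau <= t -> s t <= c.

Let bounded_sez :
  [/\ bounded_after tau s, bounded_after tau e & bounded_after tau z].
Proof.
have [B HB] := @energy_coercive _ a c g (energy a c g (s tau) (e tau) (z tau)) a0 c0 g0 ga.
have V t : tau <= t -> [/\ `|s t| <= B, `|e t| <= B & `|z t| <= B].
  move=> taut; apply: HB; first exact: sc.
  apply: (energy_le a0 c0 g0 ga gc dm (lexx tau) taut) => r /andP[taur _].
  exact: sc.
by split; exists B => t /V[].
Qed.

Let ae_motion T : tau < T ->
  {ae @lebesgue_measure R, forall t, tau < t < T -> exists2 w,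
    admissible_velocity c M g (s t) (e t) w /\ (s t = c -> w = 0) &
    [/\ is_derive t 1 s w,
        is_derive t 1 e (- c * e t + a * z t * s t + restoring a c g (s t)) &
        is_derive t 1 z (- c * z t - e t * s t / a - g / (a * c) * w)]}.
Proof.
move=> tauT; apply: (confined_motion dm (lexx tau) tauT) => t /andP[taut _].
exact: sc.
Qed.

Let velocity_eq t w : tau <= t ->
  admissible_velocity c M g (s t) (e t) w -> (s t = c -> w = 0) -> w = e t \/ w = 0.
Proof.
move=> /sc; rewrite le_eqVlt => /predU1P[st _ w0|st [w1 _ _] _].
  by right; exact: w0.
by left; exact: w1.
Qed.

Let acs T : tau < T -> absolutely_continuous tau T s. Proof. by case/dm. Qed.

Let ace T : tau < T -> absolutely_continuous tau T e. Proof. by case/dm. Qed.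

Let acz T : tau < T -> absolutely_continuous tau T z. Proof. by case/dm. Qed.

Let restoring_fun : R -> R := cst (c * g) + cst (- a) * s + cst (g / c) * (s * s).

Let restoring_funE t : restoring_fun t = restoring a c g (s t).
Proof. by rewrite /restoring_fun /restoring !fctE /=; ring. Qed.

Let bounded_restoring : bounded_after tau restoring_fun.
Proof.
have [bs _ _] := bounded_sez; have K k := @bounded_after_cst R tau k.
exact: bounded_afterD (bounded_afterD (K _) (bounded_afterM (K _) bs))
  (bounded_afterM (K _) (bounded_afterM bs bs)).
Qed.

Let lipschitz_s : lipschitz_after tau s.
Proof.
have [_ be _] := bounded_sez; apply: ac_lipschitz_after acs be _ => T tauT.
apply: ae_imply (ae_motion tauT) => t h tT _; have [w [w1 w2] [[_ ->] _ _]] := h tT.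
have [->//|->] := velocity_eq (ltW (andP tT).1) w1 w2.
by rewrite normr0.
Qed.

Let lipschitz_e : lipschitz_after tau e.
Proof.
have [bs be bz] := bounded_sez; have K k := @bounded_after_cst R tau k.
apply: (@ac_lipschitz_after _ _ _ (cst (- c) * e + cst a * z * s + restoring_fun) ace).
  exact: bounded_afterD (bounded_afterD (bounded_afterM (K _) be)
    (bounded_afterM (bounded_afterM (K _) bz) bs)) bounded_restoring.
move=> T tauT; apply: ae_imply (ae_motion tauT) => t h tT _.
have [w _ [_ [_ ->] _]] := h tT.
by rewrite !fctE/= restoring_funE.
Qed.

Let lipschitz_z : lipschitz_after tau z.
Proof.
have [bs be bz] := bounded_sez; have K k := @bounded_after_cst R tau k.
have babs : bounded_after tau (fun t => `|e t|).
  by case: be => C eC; exists C => t /eC; rewrite normr_id.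
have babs' : bounded_after tau (fun t => `|(cst (- c) * z + cst (- a^-1) * (e * s)) t|).
  have [C fC] : bounded_after tau (cst (- c) * z + cst (- a^-1) * (e * s)).
    exact: bounded_afterD (bounded_afterM (K _) bz)
      (bounded_afterM (K _) (bounded_afterM be bs)).
  by exists C => t /fC; rewrite normr_id.
apply: (@ac_lipschitz_after _ _ _ ((fun t => `|(cst (- c) * z + cst (- a^-1) * (e * s)) t|)
   + cst (g / (a * c)) * (fun t => `|e t|)) acz).
  exact: bounded_afterD babs' (bounded_afterM (K _) babs).
move=> T tauT; apply: ae_imply (ae_motion tauT) => t h tT _.
have [w [w1 w2] [_ _ [_ ->]]] := h tT.
have gac : 0 <= g / (a * c) by rewrite divr_ge0 ?mulr_ge0 ?ltW.
have wle : `|w| <= `|e t|.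
  by have [->//|->] := velocity_eq (ltW (andP tT).1) w1 w2; rewrite normr0.
rewrite !fctE /=.
rewrite [leRHS]ger0_norm; last by rewrite addr_ge0// mulr_ge0.
rewrite (_ : _ - _ = (- c * z t + - a^-1 * (e t * s t)) + (- (g / (a * c)) * w)).
  apply: (le_trans (ler_normD _ _)); rewrite lerD2l normrM normrN (ger0_norm gac).
  by rewrite ler_wpM2l.
by rewrite [e t * s t / a]mulrC; ring.
Qed.

Let vanishes_dissipation d : 0 < d ->
  exists T, forall t, T <= t -> dissipation a c g (e t) (z t) < d.
Proof.
move=> d0; have [bs be bz] := bounded_sez; have K k := @bounded_after_cst R tau k.
have KL k := @lipschitz_after_cst R tau k.
pose G : R -> R := cst (c * (1 - g / (2 * c ^+ 2))) * (e * e + cst (a ^+ 2) * (z * z)).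
have GE t : G t = dissipation a c g (e t) (z t).
  by rewrite /G /dissipation !fctE /=; ring.
have [L GL] : lipschitz_after tau G.
  have lee : lipschitz_after tau (e * e) by exact: lipschitz_afterM.
  have lzz : lipschitz_after tau (z * z) by exact: lipschitz_afterM.
  have bee := bounded_afterM be be; have bzz := bounded_afterM bz bz.
  apply: lipschitz_afterM => //; last by apply: lipschitz_afterD => //; exact: lipschitz_afterM.
  exact: bounded_afterD bee (bounded_afterM (K _) bzz).
have bV : bounded_after tau (energy_fun a c g s e z).
  rewrite /energy_fun; exact: bounded_afterD
    (bounded_afterD (bounded_afterM (K _) (bounded_afterM be be))
      (bounded_afterM (K _) (bounded_afterM bz bz)))
    (bounded_afterD (bounded_afterD (bounded_afterM (K _) (bounded_afterM bs bs))
      (bounded_afterM (K _) (bounded_afterM bs (bounded_afterM bs bs))))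
      (bounded_afterM (K _) bs)).
have [||||T HT] := @barbalat_inequality _ (energy_fun a c g s e z) G L tau d _ _ _ _ d0.
- by move=> T tauT; have [? ? ? _] := dm tauT; apply: ac_energy => //; exact: ltW.
- move=> T tauT; have h := energy_decay a0 c0 g0 ga gc dm (lexx tau) tauT.
  apply: ae_imply (h _) => [t|t /andP[taut _]]; last exact: sc.
  by rewrite GE.
- exact: GL.
- apply: (bounded_monotone_gap bV) => t t' taut tt'; rewrite !energy_funE.
  apply: (energy_le a0 c0 g0 ga gc dm taut tt') => r /andP[tr _].
  by apply: sc; exact: le_trans tr.
by exists T => t /HT; rewrite GE.
Qed.

Lemma vanishes_ez : vanishes e /\ vanishes z.
Proof.
pose k := c * (1 - g / (2 * c ^+ 2)).
have k0 : 0 < k.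
  rewrite mulr_gt0// subr_gt0 ltr_pdivrMr ?mul1r//.
  by rewrite mulr_gt0// exprn_gt0.
split=> d d0.
  have [T HT] := vanishes_dissipation (mulr_gt0 k0 (exprn_gt0 2 d0)).
  exists T => t /HT; rewrite /dissipation -/k ltr_pM2l// => h.
  rewrite -(ltr_pXn2r (n := 2)) ?nnegrE// ?(ltW d0)// real_normK ?num_real//.
  by apply: le_lt_trans h; rewrite lerDl sqr_ge0.
have [T HT] := vanishes_dissipation (mulr_gt0 k0 (exprn_gt0 2 (mulr_gt0 a0 d0))).
exists T => t /HT; rewrite /dissipation -/k ltr_pM2l// => h.
rewrite -(ltr_pM2l a0) -{1}(gtr0_norm a0) -normrM.
rewrite -(ltr_pXn2r (n := 2)) ?nnegrE// ?mulr_ge0 ?ltW// real_normK ?num_real//.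
by apply: le_lt_trans h; rewrite lerDr sqr_ge0.
Qed.

(** Since [e' = restoring (s t) + o(1)] and [e] tends to 0, the inequality of
    Barbalat applies to [e] and [- e] from the time when the error term is less
    than [d / 2]. *)
Lemma vanishes_restoring : vanishes (fun t => restoring a c g (s t)).
Proof.
have [bs be bz] := bounded_sez; have K k := @bounded_after_cst R tau k.
have KL k := @lipschitz_after_cst R tau k.
have [ve vz] := vanishes_ez.
move=> d d0; have d2 : 0 < d / 2 by rewrite divr_gt0.
have small : exists2 T0, tau <= T0 & forall t, T0 <= t ->
    `|- c * e t + a * z t * s t| <= d / 2.
  have [B sB] := bs.
  have B0 : 0 <= B by apply: le_trans (sB tau (lexx _)).
  have D0 : 0 < 2 * (c + a * B + 1).
    by rewrite mulr_gt0// addr_gt0// ltr_wpDr// mulr_ge0// ltW.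
(* Once |e| and |z| are below r, the error is below (c + a B) r < d / 2. *)
  pose r := d / (2 * (c + a * B + 1)); have r0 : 0 < r by rewrite divr_gt0.
  have [T1 H1] := ve _ r0; have [T2 H2] := vz _ r0.
  exists (Num.max tau (Num.max T1 T2)); first by rewrite le_max lexx.
  move=> t; rewrite !ge_max => /and3P[taut T1t T2t].
  apply: (le_trans (ler_normD _ _)); rewrite !normrM normrN (gtr0_norm a0) (gtr0_norm c0).
  have h1 : c * `|e t| <= c * r by rewrite ler_pM2l// ltW// H1.
  have h2 : a * `|z t| * `|s t| <= a * r * B.
    apply: ler_pM => //; first by rewrite mulr_ge0// ltW.
      by rewrite ler_pM2l// ltW// H2.
    exact: sB.
  have -> : d / 2 = c * r + a * r * B + r by rewrite /r; field; lra.
  lra.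
have [T0 tauT0 HT0] := small.
have [L restoringL] : lipschitz_after tau restoring_fun.
  have lss : lipschitz_after tau (s * s) by exact: lipschitz_afterM.
  have bss := bounded_afterM bs bs.
  apply: lipschitz_afterD; last exact: lipschitz_afterM.
  by apply: lipschitz_afterD => //; exact: lipschitz_afterM.
have gap f : vanishes f -> forall k, 0 < k ->
    exists T, forall t t', T <= t -> t <= t' -> f t - f t' < k.
  move=> vf k k0; have [T HT] := vf (k / 2) (divr_gt0 k0 (ltr0n _ 2)).
  exists T => t t' Tt tt'; have := HT t Tt; have := HT t' (le_trans Tt tt').
  by rewrite !ltr_norml => /andP[? ?] /andP[? ?]; lra.
have ace' T : T0 < T -> absolutely_continuous T0 T e.
  by move=> T0T; apply: acS (ace (le_lt_trans tauT0 T0T)).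
have [|||T1 H1] := @barbalat_inequality _ e
  (fun t => - restoring_fun t - d / 2) L T0 (d / 2) ace' _ _ _ d2.
- move=> T T0T; apply: ae_imply (ae_motion (le_lt_trans tauT0 T0T)) => t h /andP[T0t tT] _.
  have [|w _ [_ [_ ->] _]] := h; first by rewrite (le_lt_trans tauT0 T0t).
  have := HT0 t (ltW T0t); rewrite restoring_funE ler_norml => /andP[_]; lra.
- move=> t t' T0t tt'.
  have -> : - restoring_fun t' - d / 2 - (- restoring_fun t - d / 2) =
      restoring_fun t - restoring_fun t' by ring.
  by rewrite distrC restoringL// (le_trans tauT0).
- exact: gap.
have [||||T2 H2] := @barbalat_inequality _ (- e)
  (fun t => restoring_fun t - d / 2) L T0 (d / 2) _ _ _ _ d2.
- move=> T T0T; apply: (@ac_dominated _ _ _ _ _ _ _ 1 _ (ace' T T0T)) => u v _ _ _.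
  by rewrite mul1r !fctE -opprD normrN.
- move=> T T0T; apply: ae_imply (ae_motion (le_lt_trans tauT0 T0T)) => t h /andP[T0t tT] _.
  have [|w _ [_ [de deE] _]] := h; first by rewrite (le_lt_trans tauT0 T0t).
  rewrite deriveN// deE.
  have := HT0 t (ltW T0t); rewrite restoring_funE ler_norml => /andP[]; lra.
- move=> t t' T0t tt'.
  have -> : restoring_fun t' - d / 2 - (restoring_fun t - d / 2) =
      restoring_fun t' - restoring_fun t by ring.
  by rewrite restoringL// (le_trans tauT0).
- by apply: gap => k k0; have [T HT] := ve k k0; exists T => t /HT; rewrite fctE normrN.
exists (Num.max T1 T2) => t; rewrite ge_max => /andP[T1t T2t].
have := H1 t T1t; have := H2 t T2t; rewrite /= restoring_funE => h2 h1.
rewrite !ltrBlDr -!splitr in h1 h2.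
by rewrite ltr_norml ltrNl h1 h2.
Qed.

(** On s <= c, [restoring s] is the product of [s1 - s] with a factor that is at
    least [a - 2 * g > 0]. *)
Lemma vanishes_s s1 : s1 < c -> restoring a c g s1 = 0 -> vanishes (fun t => s t - s1).
Proof.
move=> s1c root1 d d0; have k0 : 0 < a - 2 * g by have := ga; lra.
have [T HT] := vanishes_restoring (mulr_gt0 k0 d0).
exists (Num.max tau T) => t; rewrite ge_max => /andP[taut Tt].
have := HT t Tt; rewrite -(subr0 (restoring a c g (s t))) -root1.
have -> : restoring a c g (s t) - restoring a c g s1 = - ((a - g / c * (s t + s1)) * (s t - s1)).
  by rewrite /restoring; ring.
have gst : g / c * (s t + s1) <= 2 * g.
  have -> : 2 * g = g / c * (2 * c) by field; rewrite gt_eqF.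
  by rewrite ler_wpM2l ?divr_ge0 ?ltW//; have := sc taut; lra.
rewrite normrN normrM ger0_norm; last by lra.
move=> h; rewrite -(ltr_pM2l k0); apply: le_lt_trans h.
by apply: ler_wpM2r => //; lra.
Qed.

End Convergence.

(** * Equilibria and initial energy *)

Lemma small_root (R : realType) (a c g : R) :
  0 < a -> 0 < c -> 0 < g -> g < a / 2 ->
  let s := c * (a - Num.sqrt (a ^+ 2 - 4 * g ^+ 2)) / (2 * g) in
  [/\ 0 < s, s < c & g * (c ^+ 2 + s ^+ 2) = a * c * s].
Proof.
move=> a0 c0 g0 ga s; pose D := a ^+ 2 - 4 * g ^+ 2; pose q := Num.sqrt D.
have DE : D = (a - 2 * g) * (a + 2 * g) by rewrite /D; ring.
have a2g : 0 < a - 2 * g by lra.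
have D0 : 0 < D by rewrite DE mulr_gt0//; lra.
have q2 : q ^+ 2 = D by rewrite sqr_sqrtr// ltW.
have q0 : 0 <= q by exact: sqrtr_ge0.
have qa : q < a.
  rewrite -(ltr_pXn2r (n := 2)) ?nnegrE ?(ltW a0)// q2 /D.
  by rewrite ltrBlDr ltrDl mulr_gt0// exprn_gt0.
have aq : a - 2 * g < q.
  rewrite -(ltr_pXn2r (n := 2)) ?nnegrE ?(ltW a2g)// q2 DE expr2.
  by rewrite ltr_pM2l//; lra.
have g2 : 0 < 2 * g by rewrite mulr_gt0.
split.
- by rewrite /s divr_gt0// mulr_gt0// subr_gt0.
- by rewrite /s ltr_pdivrMr// ltr_pM2l//; move: aq; rewrite /q /D; lra.
- rewrite /s -/D -/q.
  have -> : g * (c ^+ 2 + (c * (a - q) / (2 * g)) ^+ 2) =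
     c ^+ 2 * (4 * g ^+ 2 + a ^+ 2 - 2 * a * q + q ^+ 2) / (4 * g).
    by field; rewrite gt_eqF.
  by rewrite q2 /D; field; rewrite gt_eqF.
Qed.

(** The initial state is the equilibrium for the load [g0].  With [r = s0 / c]
    and the equation [g0 * (1 + r ^+ 2) = a * r] the difference of the two sides
    becomes a sum of positive terms. *)
Lemma initial_energy (R : realType) (a c g0 g s0 : R) :
  0 < a -> 0 < c -> 0 < g0 -> g0 < g -> g < a / 2 ->
  0 < s0 -> s0 < c -> g0 * (c ^+ 2 + s0 ^+ 2) = a * c * s0 ->
  energy a c g s0 (g - g0) (- ((g - g0) * s0 / (a * c))) < g ^+ 2 / 2.
Proof.
move=> a0 c0 g00 gg ga s00 s0c eq0; have aneq : a != 0 by rewrite gt_eqF.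
have cneq : c != 0 by rewrite gt_eqF.
pose r := s0 / c; have r0 : 0 < r by rewrite divr_gt0.
have r1 : r < 1 by rewrite ltr_pdivrMr// mul1r.
have s0E : s0 = c * r by rewrite /r mulrC divfK.
have eqr : g0 * (1 + r ^+ 2) = a * r.
  apply: (mulfI (x := c ^+ 2)); first by rewrite expf_neq0.
  by rewrite mulrCA mulrDr mulr1 -exprMn -s0E eq0 s0E; ring.
have P1 : 0 < a / 4 - g * r / 2.
  have : g * r < a / 2 * 1 by apply: ltr_pM => //; lra.
  lra.
have P2 : 0 < (g - g0) * (1 + r ^+ 2) / 2 + g * (1 / 2 - r ^+ 2 / 6).
  have r2 : r ^+ 2 < 1 by rewrite exprn_ilt1 ?ltW// gt_eqF.
  have r20 := sqr_ge0 r.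
  by rewrite addr_gt0// ?divr_gt0 ?mulr_gt0//; lra.
rewrite -subr_gt0.
have -> : g ^+ 2 / 2 - energy a c g s0 (g - g0) (- ((g - g0) * s0 / (a * c))) =
  g * r * (a / 4 - g * r / 2) + g * a * r / 4 + (g - g0) * (a * r) / 2 +
  c ^+ 2 * r * ((g - g0) * (1 + r ^+ 2) / 2 + g * (1 / 2 - r ^+ 2 / 6))
  + c ^+ 2 * r / 2 * (g0 * (1 + r ^+ 2) - a * r)
  + (g - g0 / 2) * (g0 * (1 + r ^+ 2) - a * r).
  by rewrite /energy /potential s0E; field; rewrite aneq cneq.
rewrite eqr subrr !mulr0 !addr0.
have gp : 0 < g by lra.
have T1 : 0 < g * r * (a / 4 - g * r / 2) by rewrite mulr_gt0// mulr_gt0.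
have T2 : 0 < g * a * r / 4 by rewrite !mulr_gt0 ?invr_gt0.
have T3 : 0 < (g - g0) * (a * r) / 2.
  by rewrite !mulr_gt0 ?subr_gt0 ?invr_gt0.
have T4 := mulr_gt0 (mulr_gt0 (exprn_gt0 2 c0) r0) P2.
exact: addr_gt0 (addr_gt0 (addr_gt0 T1 T2) T3) T4.
Qed.

Lemma drill_equilibrium (R : realType) (a c M g s1 : R) :
  0 < a -> 0 < c -> s1 < c -> g * (c ^+ 2 + s1 ^+ 2) = a * c * s1 ->
  is_equilibrium (drilling_system a c M g)
    (s1, - g / a, - (g * s1) / (a * c)).
Proof.
move=> a0 c0 s1c eq1 tau; have aneq : a != 0 by rewrite gt_eqF.
have cneq : c != 0 by rewrite gt_eqF.
split.
  move=> T _ e e0; exists 1 => // n p q _ _ _.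
  by rewrite big1// => i _; rewrite subrr normr0.
move=> t _ _; rewrite derive_cst; exists g; first by rewrite /Mf_ext s1c.
congr (_, _, _).
- by field.
- have -> : - c * (- g / a) - s1 - - (g * s1) / (a * c) * s1 =
     (g * (c ^+ 2 + s1 ^+ 2) - a * c * s1) / (a * c).
    by field; rewrite aneq cneq.
  by rewrite eq1 subrr mul0r.
- by field; rewrite aneq cneq.
Qed.

Theorem theorem9p2 (R : realType) (a c M gamma0 gamma1 tau : R)
    (s y x : R -> R) :
  0 < a -> 0 < c -> 0 < M -> 0 < gamma0 -> gamma0 < gamma1 ->
  gamma0 < a / 2 ->
  gamma1 < Num.min (a / 2) (2 * c ^+ 2) ->
  0 <= 3 * (M ^+ 2 + 2 * M) * gamma1 ^+ 2 - 8 * c ^+ 2 * gamma1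
       + 3 * a * c ^+ 2 ->
  let s0 := c * (a - Num.sqrt (a ^+ 2 - 4 * gamma0 ^+ 2)) / (2 * gamma0) in
  is_solution (drilling_system a c M gamma1) tau (fun t => (s t, y t, x t)) ->
  s tau = s0 ->
  y tau = - gamma0 / a ->
  x tau = - (gamma0 * s0) / (a * c) ->
  exists2 p : R * R * R, is_equilibrium (drilling_system a c M gamma1) p &
    (s t, y t, x t) @[t --> +oo] --> p.
Proof.
move=> a0 c0 M0 g00 g01 g0a; rewrite lt_min => /andP[ga gc] cond s0 sol stau ytau xtau.
have g0 : 0 < gamma1 by exact: lt_trans g01.
have aneq : a != 0 by rewrite gt_eqF.
have cneq : c != 0 by rewrite gt_eqF.
have gneq : gamma1 != 0 by rewrite gt_eqF.
have [s00 s0c eq0] := small_root a0 c0 g00 g0a; rewrite -/s0 in s00 s0c eq0.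
have := small_root a0 c0 g0 ga.
set s1 := c * _ / _ => -[s10 s1c eq1].
have dm := solution_motion a0 c0 sol.
set e := cst a * y + cst gamma1 in dm; set z := cst (- 1) * x + _ in dm.
have etau : e tau = gamma1 - gamma0 by rewrite /e !fctE/= ytau; field.
have ztau : z tau = - ((gamma1 - gamma0) * s0 / (a * c)).
  by rewrite /z !fctE/= xtau stau; field; rewrite aneq cneq.
have sc : forall t, tau <= t -> s t <= c.
  apply: (no_exit a0 c0 M0 g0 ga gc dm); first by rewrite stau ltW.
  rewrite stau etau ztau.
  apply: (lt_le_trans (initial_energy a0 c0 g00 g01 ga s00 s0c eq0)).
  rewrite -subr_ge0 (_ : _ - _ = (3 * (M ^+ 2 + 2 * M) * gamma1 ^+ 2
    - 8 * c ^+ 2 * gamma1 + 3 * a * c ^+ 2) / 6); first by rewrite divr_ge0.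
  by rewrite /potential; field.
have [ve vz] := vanishes_ez a0 c0 g0 ga gc dm sc.
have root1 : restoring a c gamma1 s1 = 0.
  rewrite /restoring (_ : _ + _ = (gamma1 * (c ^+ 2 + s1 ^+ 2) - a * c * s1) / c).
    by rewrite eq1 subrr mul0r.
  by field.
have vs := vanishes_s a0 c0 g0 ga gc dm sc s1c root1.
have cs : s t @[t --> +oo] --> s1 by exact: vanishes_cvg.
have ce : e t @[t --> +oo] --> (0 : R).
  by apply: vanishes_cvg => d /ve[T HT]; exists T => t /HT; rewrite subr0.
have cz : z t @[t --> +oo] --> (0 : R).
  by apply: vanishes_cvg => d /vz[T HT]; exists T => t /HT; rewrite subr0.
exists (s1, - gamma1 / a, - (gamma1 * s1) / (a * c)).
  exact: drill_equilibrium.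
have yE : y = fun t => (e t - gamma1) / a.
  by apply/funext => t; rewrite /e !fctE/=; field.
have xE : x = fun t => - z t - gamma1 / (a * c) * s t.
  by apply/funext => t; rewrite /z !fctE/=; ring.
have cy : y t @[t --> +oo] --> - gamma1 / a.
  rewrite yE (_ : - gamma1 / a = (0 - gamma1) / a); last by rewrite sub0r.
  apply: cvgM; last exact: cvg_cst.
  by apply: cvgB; [exact: ce|exact: cvg_cst].
have cx : x t @[t --> +oo] --> - (gamma1 * s1) / (a * c).
  rewrite xE (_ : - (gamma1 * s1) / (a * c) = - 0 - gamma1 / (a * c) * s1);
    last by field; rewrite aneq cneq.
  apply: cvgB; first exact: (cvgN cz).
  by apply: cvgM; [exact: cvg_cst|exact: cs].
exact: (cvg_pair (cvg_pair cs cy) cx).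
Qed.
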